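(* Let $\mathbf k$ be a field, $G$ a finite group with $\operatorname{char}\mathbf k$ zero or coprime to $|G|$, and $\mathcal D$ a $\mathbf k$-linear cocomplete triangulated category with a dg-enhancement to which a given $G$-action on $\mathcal D$ lifts, and such that $\mathcal D^c$ is Hom-finite. Let $$(E_{1,1},\dots,E_{1,\ell_1},E_{2,1},\dots,E_{2,\ell_2},\dots,E_{k,1},\dots,E_{k,\ell_k})$$ be a full strong exceptional collection in $\mathcal D$ such that for each $i=1,\dots,k$ there is a transitive $G$-action on $\{1,\dots,\ell_i\}$ with $g_*E_{i,j}\cong E_{i,g(j)}$ for all $g\in G$, $j\in\{1,\dots,\ell_i\}$. Let $H_i\le G$ be the stabiliser of $1\in\{1,\dots,\ell_i\}$, and assume that for each $i$ there is $\mathcal E_i\in\mathcal D^{H_i}$ with $\operatorname{Res}_{H_i}^1(\mathcal E_i)=E_{i,1}$. Put $$\mathbb E=\bigoplus_{i=1}^k\bigoplus_{j=1}^{\ell_i}E_{i,j}\in\mathcal D,\qquad\mathbb F=\bigoplus_{i=1}^k\bigoplus_{\rho\in\operatorname{irr}(H_i)}\operatorname{Ind}_{H_i}^G(\rho\otimes_{\mathbf k}\mathcal E_i)\in\mathcal D^G.$$ Then there is an isomorphism of $\mathbf k$-algebras $$\operatorname{End}_{\mathcal D^G}(\mathbb F)\cong\bigl(G\ltimes\operatorname{End}_{\mathcal D}(\mathbb E)\bigr)^b.$$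
   Context: $\mathcal D$ cocomplete means arbitrary (set-indexed) direct sums exist; a dg-enhancement is a pretriangulated dg-category $\widehat{\mathcal D}$ over $\mathbf k$ with homotopy category $[\widehat{\mathcal D}]=\mathcal D$. $\mathcal D^c$ is the subcategory of compact objects ($F$ such that $\operatorname{Hom}(F,-)$ commutes with arbitrary direct sums). $\operatorname{Hom}^*(E,F)=\bigoplus_{n\in\mathbb Z}\operatorname{Hom}(E,F[n])$, $\operatorname{End}^*(E)=\operatorname{Hom}^*(E,E)$. Hom-finite means $\operatorname{Hom}^*(E,F)$ is finite-dimensional for all $E,F\in\mathcal D^c$. A $G$-action on $\mathcal D$ consists of autoequivalences $g_*\colon\mathcal D\to\mathcal D$ ($g\in G$) and isomorphisms of functors $\varepsilon_{g,h}\colon g_*\circ h_*\xrightarrow{\sim}(gh)_*$ satisfying the usual (associativity) compatibility condition. It lifts to the dg-enhancement if it is induced by an action of $G$ on $\widehat{\mathcal D}$ by dg-autoequivalences. The equivariant category $\mathcal D^G$ has objects $(E,\lambda)$ with $E\in\mathcal D$ and $\lambda=(\lambda_g\colon E\xrightarrow{\sim}g_*E)_{g\in G}$ satisfying $\varepsilon_{g,h}\circ g_*\lambda_h\circ\lambda_g=\lambda_{gh}$ (a $G$-linearisation); $\operatorname{Hom}_{\mathcal D^G}((E,\lambda),(F,\mu))=\operatorname{Hom}_{\mathcal D}(E,F)^G$, the invariants under ${}^g\varphi=\mu_g^{-1}\circ g_*\varphi\circ\lambda_g$; the corresponding right action is $\varphi^g:={}^{g^{-1}}\varphi$. Under these assumptions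 $\mathcal D^G$ is again a dg-enhanced cocomplete $\mathbf k$-linear triangulated category (direct sums, shifts and exact triangles being inherited from $\mathcal D$). For $H\le G$ the restriction functor $\operatorname{Res}_G^H\colon\mathcal D^G\to\mathcal D^H$, $(E,\lambda)\mapsto(E,\lambda|_H)$, has the induction functor $\operatorname{Ind}_H^G$ as left and right adjoint; the object underlying $\operatorname{Ind}_H^G(E)$ is $\bigoplus_{[g]\in G/H}g_*E$. Here $\mathcal D^1=\mathcal D$ for the trivial group $1$. $\operatorname{irr}(H)$ is the set of isomorphism classes of irreducible finite-dimensional right $\mathbf k$-representations of $H$; for such $(V,\rho)$ and $\mathcal E=(E,\lambda)\in\mathcal D^H$, $\rho\otimes_{\mathbf k}\mathcal E$ is $V\otimes_{\mathbf k}E\ (\cong E^{\oplus\dim V})$ with linearisation $\rho_g\otimes\lambda_g$. A compact object $E$ is exceptional if $\operatorname{End}^*(E)$ is concentrated in degree $0$ and $\operatorname{End}(E)=\mathbf k\cdot\operatorname{id}_E$. A sequence of exceptional objects is an exceptional collection if $\operatorname{Hom}^*(E,E')=0$ whenever $E$ comes strictly after $E'$; it is strong if $\operatorname{Hom}^*(E,E')$ is concentrated in degree $0$ for all members $E,E'$; it is full if the direct sum $C$ of its members is a compact generator, i.e. $C$ is compact and $\operatorname{Hom}^*(C,F)=0$ implies $F\cong0$. The object $\mathbb E$ is isomorphic to $\operatorname{Res}_G^1\bigl(\bigoplus_{i=1}^k\operatorname{Ind}_{H_i}^G\mathcal E_i\bigr)$. Via this isomorphism $\mathbb E$ carries a $G$-linearisation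 $\lambda=(\lambda_g\colon\mathbb E\xrightarrow{\sim}g_*\mathbb E)_{g\in G}$, and $G$ acts on $\operatorname{End}_{\mathcal D}(\mathbb E)$ from the right by algebra automorphisms via $\varphi\mapsto\varphi^g={}^{g^{-1}}\varphi=\lambda_{g^{-1}}^{-1}\circ(g^{-1})_*\varphi\circ\lambda_{g^{-1}}$. For a $\mathbf k$-algebra $A$ with a right $G$-action by $\mathbf k$-algebra automorphisms $a\mapsto a^g$, the skew group algebra $G\ltimes A$ is the vector space $\mathbf k\langle G\rangle\otimes_{\mathbf k}A$, with the pure tensor of $g$ and $a$ written $(g,a)$, and multiplication extending $(g,a)\cdot(h,b)=(gh,a^hb)$ bilinearly. A finite-dimensional algebra is basic if the indecomposable summands of its Krull–Remak–Schmidt decomposition as a right module over itself are pairwise non-isomorphic. For a finite-dimensional algebra $B$, its basic reduction $B^b$ is the basic algebra, unique up to isomorphism, that is Morita equivalent to $B$. *)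

(* Defs.v *)
From HB Require Import structures.
From mathcomp Require Import all_boot all_order all_algebra all_fingroup.
From mathcomp Require Import mxrepresentation.
From mathcomp Require Import boolp functions.

Set Implicit Arguments.
Unset Strict Implicit.
Unset Printing Implicit Defensive.

Import GRing.Theory.
Local Open Scope ring_scope.

#[local] Obligation Tactic := idtac.

(* Universe of the index sets of direct sums; it is not tied to the universe
   of the objects of a category. *)
Definition small := Type.

Record lincat (k : fieldType) := LinCat {
  ob :> Type;
  mor : ob -> ob -> lmodType k;
  mid : forall X, mor X X;
  mcomp : forall X Y Z, mor Y Z -> mor X Y -> mor X Z;
  comp1m : forall X Y (f : mor X Y), mcomp (mid Y) f = f;
  compm1 : forall X Y (f : mor X Y), mcomp f (mid X) = f;
  compmA : forall W X Y Z (h : mor Y Z) (g : mor X Y) (f : mor W X),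
    mcomp h (mcomp g f) = mcomp (mcomp h g) f;
  comp_linl : forall X Y Z (f : mor X Y) a (g g' : mor Y Z),
    mcomp (a *: g + g') f = a *: mcomp g f + mcomp g' f;
  comp_linr : forall X Y Z (g : mor Y Z) a (f f' : mor X Y),
    mcomp g (a *: f + f') = a *: mcomp g f + mcomp g f' }.

Arguments mor {k l} X Y.
Arguments mid {k l} X.
Arguments mcomp {k l X Y Z} g f.

Declare Scope cat_scope.
Delimit Scope cat_scope with C.
Notation "g ∘ f" := (mcomp g f)
  (at level 40, left associativity, format "g  ∘  f") : cat_scope.
Local Open Scope cat_scope.

Record functor (k : fieldType) (C D : lincat k) := Functor {
  fob :> C -> D;
  fmap : forall X Y, mor X Y -> mor (fob X) (fob Y);
  fmap_lin : forall X Y a (f g : mor X Y),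
    fmap (a *: f + g) = a *: fmap f + fmap g;
  fmap1 : forall X, fmap (mid X) = mid (fob X);
  fmapM : forall X Y Z (g : mor Y Z) (f : mor X Y),
    fmap (g ∘ f) = fmap g ∘ fmap f }.

Arguments fmap {k C D} F {X Y} f : rename.

Section Categories.
Variable k : fieldType.
Implicit Types C D : lincat k.

Record iso C (X Y : C) := Iso {
  isohom : mor X Y;
  isoinv : mor Y X;
  isoK : isoinv ∘ isohom = mid X;
  isoVK : isohom ∘ isoinv = mid Y }.

Definition isomorphic C (X Y : C) : Prop := inhabited (iso X Y).

Definition is_zero C (X : C) : Prop := mid X = 0.

Definition is_equivalence C D (F : functor C D) : Prop :=
  (forall X Y : C, bijective (fmap F : mor X Y -> mor (F X) (F Y))) /\
  (forall Y : D, exists X : C, isomorphic (F X) Y).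

(* Naturality of [t : F => G]; the functors are given by their actions on
   objects and morphisms so that composites need not be packed. *)
Definition natural C D (F G : C -> D)
    (Fm : forall X Y, mor X Y -> mor (F X) (F Y))
    (Gm : forall X Y, mor X Y -> mor (G X) (G Y))
    (t : forall X, iso (F X) (G X)) : Prop :=
  forall X Y (f : mor X Y), Gm X Y f ∘ isohom (t X) = isohom (t Y) ∘ Fm X Y f.

(* [F] is left adjoint to [U]. *)
Definition adjoint C D (F : functor C D) (U : functor D C) : Prop :=
  exists alpha : forall X Y, mor (F X) Y -> mor X (U Y),
    (forall X Y, bijective (@alpha X Y)) /\
    (forall X' X Y Y' (f : mor X' X) (u : mor (F X) Y) (g : mor Y Y'),
        alpha X' Y' (g ∘ u ∘ fmap F f) = fmap U g ∘ alpha X Y u ∘ f).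

(* [P], with the morphisms [inj i], is the direct sum of the [X i]. *)
Definition is_dsum C (I : small) (X : I -> C) (P : C)
    (inj : forall i, mor (X i) P) : Prop :=
  forall (Y : C) (f : forall i, mor (X i) Y),
    exists! u : mor P Y, forall i, u ∘ inj i = f i.

Definition cocomplete C : Prop :=
  forall (I : small) (X : I -> C), exists P inj, @is_dsum C I X P inj.

(* Hom(K, -) commutes with direct sums: the canonical map from the direct sum
   of the Hom(K, X i) to Hom(K, P) is surjective and injective. Elements of
   the former are given by finitely many components at distinct indices. *)
Definition compact C (K : C) : Prop :=
  forall (I : small) (X : I -> C) (P : C) (inj : forall i, mor (X i) P),
    is_dsum inj ->
    (forall f : mor K P, exists n (j : 'I_n -> I) (g : forall a, mor K (X (j a))),
        injective j /\ f = \sum_a inj (j a) ∘ g a) /\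
    (forall n (j : 'I_n -> I) (g : forall a, mor K (X (j a))),
        injective j -> \sum_a inj (j a) ∘ g a = 0 -> forall a, g a = 0).

Definition indecomposable C (X : C) : Prop :=
  ~ is_zero X /\
  (forall (N : bool -> C) (inj : forall b, mor (N b) X),
      is_dsum inj -> exists b, is_zero (N b)).

Definition fin_dim (V : lmodType k) : Prop :=
  exists n (b : 'I_n -> V), forall v, exists c : 'I_n -> k,
    v = \sum_i c i *: b i.

End Categories.

Arguments isohom {k C X Y} i.
Arguments isoinv {k C X Y} i.
Arguments is_dsum {k C I X P} inj.

Section TriangleNotions.
Variables (k : fieldType) (C : lincat k) (shift1 : functor C C).

Record triangle := Triangle {
  tX : C; tY : C; tZ : C;
  tf : mor tX tY; tg : mor tY tZ; th : mor tZ (shift1 tX) }.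

Definition tri_iso (S T : triangle) : Prop :=
  exists (a : iso (tX S) (tX T)) (b : iso (tY S) (tY T)) (c : iso (tZ S) (tZ T)),
    [/\ tf T ∘ isohom a = isohom b ∘ tf S,
        tg T ∘ isohom b = isohom c ∘ tg S
      & th T ∘ isohom c = fmap shift1 (isohom a) ∘ th S].

End TriangleNotions.

Arguments Triangle {k C shift1 tX tY tZ} tf tg th.

Record tricat (k : fieldType) := TriCat {
  tcat :> lincat k;
  finite_dsums : forall n (X : 'I_n -> tcat), exists P inj, @is_dsum k tcat _ X P inj;
  shift1 : functor tcat tcat;
  unshift1 : functor tcat tcat;
  sh_unit : forall X, iso X (unshift1 (shift1 X));
  sh_unit_nat : natural (fun _ _ f => f) (fun _ _ f => fmap unshift1 (fmap shift1 f)) sh_unit;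
  sh_counit : forall X, iso (shift1 (unshift1 X)) X;
  sh_counit_nat : natural (fun _ _ f => fmap shift1 (fmap unshift1 f)) (fun _ _ f => f) sh_counit;
  dist : triangle shift1 -> Prop;
  dist_iso : forall S T, tri_iso S T -> dist S -> dist T;
  dist_id : forall X Z (g : mor X Z) (h : mor Z (shift1 X)), is_zero Z ->
    dist (Triangle (mid X) g h);
  dist_cone : forall X Y (f : mor X Y), exists Z (g : mor Y Z) (h : mor Z (shift1 X)),
    dist (Triangle f g h);
  dist_rot : forall X Y Z (f : mor X Y) (g : mor Y Z) (h : mor Z (shift1 X)),
    dist (Triangle f g h) <-> dist (Triangle g h (- fmap shift1 f));
  dist_fill : forall S T : triangle shift1, dist S -> dist T ->
    forall (a : mor (tX S) (tX T)) (b : mor (tY S) (tY T)),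
      tf T ∘ a = b ∘ tf S ->
      exists c : mor (tZ S) (tZ T),
        tg T ∘ b = c ∘ tg S /\ th T ∘ c = fmap shift1 a ∘ th S;
  octahedral : forall X Y Z X' Y' Z'
      (f : mor X Y) (a : mor Y Z') (a' : mor Z' (shift1 X))
      (g : mor Y Z) (b : mor Z X') (b' : mor X' (shift1 Y))
      (c : mor Z Y') (c' : mor Y' (shift1 X)),
    dist (Triangle f a a') -> dist (Triangle g b b') ->
    dist (Triangle (g ∘ f) c c') ->
    exists (u : mor Z' Y') (v : mor Y' X'),
      [/\ dist (Triangle u v (fmap shift1 a ∘ b')),
          u ∘ a = c ∘ g, c' ∘ u = a', v ∘ c = b
        & b' ∘ v = fmap shift1 f ∘ c'] }.

Section TriangulatedNotions.
Variables (k : fieldType) (D : tricat k).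

Definition shz (X : D) (n : int) : D :=
  match n with
  | Posz m => iter m (@shift1 k D) X
  | Negz m => iter m.+1 (@unshift1 k D) X
  end.

Definition exact_functor (F : functor D D) : Prop :=
  exists theta : forall X, iso (F (shift1 D X)) (shift1 D (F X)),
    natural (fun _ _ f => fmap F (fmap (shift1 D) f))
            (fun _ _ f => fmap (shift1 D) (fmap F f)) theta /\
    (forall X Y Z (f : mor X Y) (g : mor Y Z) (h : mor Z (shift1 D X)),
        dist (Triangle f g h) ->
        dist (Triangle (fmap F f) (fmap F g) (isohom (theta X) ∘ fmap F h))).

(* Hom^*(E, F) is finite-dimensional, a direct sum over the integers being
   finite-dimensional iff its terms are and almost all of them vanish. *)
Definition hom_finite : Prop :=
  forall E F : D, compact E -> compact F ->
    (forall n, fin_dim (mor E (shz F n))) /\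
    (exists N : nat, forall n : int, (N < `|n|)%N ->
        forall f : mor E (shz F n), f = 0).

Definition hom_zero (E F : D) : Prop :=
  forall n (f : mor E (shz F n)), f = 0.

Definition hom_degree0 (E F : D) : Prop :=
  forall n, n != 0 -> forall f : mor E (shz F n), f = 0.

Definition exceptional (E : D) : Prop :=
  [/\ compact E, hom_degree0 E E & bijective (fun a : k => a *: mid E)].

Definition compact_generator (K : D) : Prop :=
  compact K /\ (forall F : D, hom_zero K F -> is_zero F).

(* [before] is the (strict) order of the sequence. *)
Record full_strong_exceptional_collection (I : finType) (before : rel I)
    (E : I -> D) : Prop := FullStrongExceptionalCollection {
  fsec_exceptional : forall p, exceptional (E p);
  fsec_semiorthogonal : forall p q, before p q -> hom_zero (E q) (E p);
  fsec_strong : forall p q, hom_degree0 (E p) (E q);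
  fsec_full : exists K (inj : forall p, mor (E p) K),
    is_dsum inj /\ compact_generator K }.

End TriangulatedNotions.

(* Order of the pairs (i, j) in
   (1,1), ..., (1,l_1), (2,1), ..., (2,l_2), ..., (n,1), ..., (n,l_n). *)
Definition before n (ell : 'I_n -> nat) : rel {i : 'I_n & 'I_(ell i).+1} :=
  fun p q => (tag p < tag q)%N ||
             ((tag p == tag q) && (tagged p < tagged q)%N).

Arguments before {n} ell : rename.

(* Differential of degree +1. [ddiff] and [dcomp] take proofs of the degree
   equations, since e.g. (m + n) + p and m + (n + p) are not convertible. *)
Record dgcat (k : fieldType) := DGCat {
  dob :> Type;
  dhom : dob -> dob -> int -> lmodType k;
  ddiff : forall X Y n n', n + 1 = n' -> dhom X Y n -> dhom X Y n';
  did : forall X, dhom X X 0;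
  dcomp : forall X Y Z m n p, m + n = p ->
    dhom Y Z m -> dhom X Y n -> dhom X Z p;
  ddiff_lin : forall X Y n n' (e : n + 1 = n') a (f g : dhom X Y n),
    ddiff e (a *: f + g) = a *: ddiff e f + ddiff e g;
  ddiffK : forall X Y n n' n'' (e : n + 1 = n') (e' : n' + 1 = n'')
      (f : dhom X Y n), ddiff e' (ddiff e f) = 0;
  dcomp1m : forall X Y n (e : 0 + n = n) (f : dhom X Y n), dcomp e (did Y) f = f;
  dcompm1 : forall X Y n (e : n + 0 = n) (f : dhom X Y n), dcomp e f (did X) = f;
  dcompA : forall W X Y Z m n p mn np r
      (e1 : n + p = np) (e2 : m + np = r) (e3 : m + n = mn) (e4 : mn + p = r)
      (h : dhom Y Z m) (g : dhom X Y n) (f : dhom W X p),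
    dcomp e2 h (dcomp e1 g f) = dcomp e4 (dcomp e3 h g) f;
  dcomp_linl : forall X Y Z m n p (e : m + n = p) (f : dhom X Y n) a
      (g g' : dhom Y Z m),
    dcomp e (a *: g + g') f = a *: dcomp e g f + dcomp e g' f;
  dcomp_linr : forall X Y Z m n p (e : m + n = p) (g : dhom Y Z m) a
      (f f' : dhom X Y n),
    dcomp e g (a *: f + f') = a *: dcomp e g f + dcomp e g f';
  leibniz : forall X Y Z m n p m' n' p' (e : m + n = p) (ep : p + 1 = p')
      (em : m + 1 = m') (en : n + 1 = n') (e1 : m' + n = p') (e2 : m + n' = p')
      (g : dhom Y Z m) (f : dhom X Y n),
    ddiff ep (dcomp e g f) =
      dcomp e1 (ddiff em g) f + (-1) ^+ `|m|%N *: dcomp e2 g (ddiff en f) }.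

Arguments dhom {k d} X Y n : rename.
Arguments did {k d} X : rename.
Arguments ddiff {k d X Y n n'} e f : rename.
Arguments dcomp {k d X Y Z m n p} e g f : rename.

Section DG.
Variable k : fieldType.
Implicit Types A B : dgcat k.

Definition cocycle A (X Y : A) n (f : dhom X Y n) : Prop :=
  ddiff (erefl (n + 1)) f = 0.

Definition coboundary A (X Y : A) n (f : dhom X Y n) : Prop :=
  exists m (e : m + 1 = n) (g : dhom X Y m), f = ddiff e g.

(* [s] exhibits [S] as the shift X[n], up to homotopy: composition with the
   cocycle [s] of degree -n is a homotopy equivalence from the shifted complex
   Hom(-, X)[n], whose differential carries the sign (-1)^n, to Hom(-, S). *)
Definition is_dgshift A (n : int) (X S : A) (s : dhom X S (- n)) : Prop :=
  cocycle s /\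
  exists t : dhom S X n,
    [/\ cocycle t, coboundary (dcomp (subrr n) t s - did X)
      & coboundary (dcomp (addNr n) s t - did S)].

(* [i] and [j] exhibit [K] as the cone of the cocycle [f]. The complex
   Cone(f)(W) is Hom^(m+1)(W, X) + Hom^m(W, Y) in degree m, with differential
   (x, y) |-> (- dx, f x + dy), and (x, y) |-> j x + i y is required to be a
   quasi-isomorphism Cone(f)(W) -> Hom(W, K) for every W. *)
Record is_dgcone A (X Y K : A) (f : dhom X Y 0) (i : dhom Y K 0)
    (j : dhom X K (-1)) : Prop := IsDGCone {
  cone_i : cocycle i;
  cone_j : ddiff (addNr 1) j = dcomp (addr0 0) i f;
  cone_surj : forall (W : A) m m1 (e : m + 1 = m1) (e' : -1 + m1 = m)
      (z : dhom W K m), cocycle z ->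
    exists (x : dhom W X m1) (y : dhom W Y m),
      [/\ cocycle x, dcomp (add0r m1) f x + ddiff e y = 0
        & coboundary (dcomp e' j x + dcomp (add0r m) i y - z)];
  cone_inj : forall (W : A) m m1 (e : m + 1 = m1) (e' : -1 + m1 = m)
      (x : dhom W X m1) (y : dhom W Y m),
    cocycle x -> dcomp (add0r m1) f x + ddiff e y = 0 ->
    coboundary (dcomp e' j x + dcomp (add0r m) i y) ->
    exists m0 (e0 : m0 + 1 = m) (x' : dhom W X m) (y' : dhom W Y m0),
      x = - ddiff e x' /\ y = dcomp (add0r m) f x' + ddiff e0 y' }.

Definition pretriangulated A : Prop :=
  (forall (X : A) n, exists (S : A) (s : dhom X S (- n)), is_dgshift s) /\
  (forall (X Y : A) (f : dhom X Y 0), cocycle f ->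
     exists (K : A) (i : dhom Y K 0) (j : dhom X K (-1)), is_dgcone f i j).

Record dgfunctor A B := DGFunctor {
  dgob :> A -> B;
  dgmap : forall X Y n, dhom X Y n -> dhom (dgob X) (dgob Y) n;
  dgmap_lin : forall X Y n a (f g : dhom X Y n),
    dgmap (a *: f + g) = a *: dgmap f + dgmap g;
  dgmap_diff : forall X Y n n' (e : n + 1 = n') (f : dhom X Y n),
    dgmap (ddiff e f) = ddiff e (dgmap f);
  dgmap1 : forall X, dgmap (did X) = did (dgob X);
  dgmapM : forall X Y Z m n p (e : m + n = p) (g : dhom Y Z m) (f : dhom X Y n),
    dgmap (dcomp e g f) = dcomp e (dgmap g) (dgmap f) }.

Record dgiso A (X Y : A) := DGIso {
  dghom : dhom X Y 0;
  dginv : dhom Y X 0;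
  dghom_cocycle : cocycle dghom;
  dginv_cocycle : cocycle dginv;
  dgisoK : dcomp (addr0 0) dginv dghom = did X;
  dgisoVK : dcomp (addr0 0) dghom dginv = did Y }.

Definition dgequivalence A B (F : dgfunctor A B) : Prop :=
  (forall (X Y : A) n, bijective (@dgmap A B F X Y n)) /\
  (forall Y : B, exists X : A, inhabited (dgiso (F X) Y)).

(* As for [gaction] below, the isomorphism g_* h_* -> u_* takes a proof of
   g h = u, since (g h) l and g (h l) are not convertible. *)
Record dgaction (gT : finGroupType) A := DGAction {
  dgact :> gT -> dgfunctor A A;
  dgact_equiv : forall g, dgequivalence (dgact g);
  dgeps : forall g h u, (g * h)%g = u ->
    forall X, dgiso (dgact g (dgact h X)) (dgact u X);
  dgeps_nat : forall g h u (e : (g * h)%g = u) (X Y : A) n (f : dhom X Y n),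
    dcomp (add0r n) (dghom (dgeps e Y)) (dgmap (dgact g) (dgmap (dgact h) f))
    = dcomp (addr0 n) (dgmap (dgact u) f) (dghom (dgeps e X));
  dgeps_assoc : forall g h l gh hl ghl
      (e1 : (g * h)%g = gh) (e2 : (h * l)%g = hl)
      (e3 : (gh * l)%g = ghl) (e4 : (g * hl)%g = ghl) X,
    dcomp (addr0 0) (dghom (dgeps e3 X)) (dghom (dgeps e1 (dgact l X)))
    = dcomp (addr0 0) (dghom (dgeps e4 X)) (dgmap (dgact g) (dghom (dgeps e2 X))) }.

End DG.

(* A dg-enhancement of [D]: a pretriangulated dg-category with an exact
   equivalence from its homotopy category to [D]. The homotopy category
   (cocycles of degree 0 modulo coboundaries) is not built: the equivalence is
   given by [H0ob] on objects and by [H0mor] on cocycles, the values of [H0mor]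
   off the cocycles being irrelevant. *)
Record dgenhancement (k : fieldType) (D : tricat k) := DGEnhancement {
  dgc :> dgcat k;
  dgc_pretriangulated : pretriangulated dgc;
  H0ob : dgc -> D;
  H0mor : forall X Y : dgc, dhom X Y 0 -> mor (H0ob X) (H0ob Y);
  H0mor_lin : forall (X Y : dgc) a (f g : dhom X Y 0), cocycle f -> cocycle g ->
    H0mor (a *: f + g) = a *: H0mor f + H0mor g;
  H0mor_1 : forall X, H0mor (did X) = mid (H0ob X);
  H0mor_M : forall (X Y Z : dgc) (g : dhom Y Z 0) (f : dhom X Y 0),
    cocycle g -> cocycle f -> H0mor (dcomp (addr0 0) g f) = H0mor g ∘ H0mor f;
  H0_full : forall (X Y : dgc) (u : mor (H0ob X) (H0ob Y)),
    exists f : dhom X Y 0, cocycle f /\ H0mor f = u;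
  H0_faithful : forall (X Y : dgc) (f : dhom X Y 0), cocycle f ->
    (H0mor f = 0 <-> coboundary f);
  H0_surj : forall Z : D, exists X : dgc, isomorphic (H0ob X) Z;
  H0_sh : forall (X S : dgc) (s : dhom X S (- 1)), is_dgshift s ->
    iso (H0ob S) (shift1 D (H0ob X));
  H0_sh_nat : forall (X S X' S' : dgc) (s : dhom X S (- 1)) (s' : dhom X' S' (- 1))
      (hs : is_dgshift s) (hs' : is_dgshift s')
      (f : dhom X X' 0) (f' : dhom S S' 0), cocycle f -> cocycle f' ->
    coboundary (dcomp (add0r (- 1)) f' s - dcomp (addr0 (- 1)) s' f) ->
    isohom (H0_sh hs') ∘ H0mor f' = fmap (shift1 D) (H0mor f) ∘ isohom (H0_sh hs);
  (* (q, r) is the cocycle of the cone mapping to the identity of [K], so that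
     [q] is the projection of the cone [K] onto X[1] *)
  H0_dist : forall (X Y K S : dgc) (f : dhom X Y 0)
      (i : dhom Y K 0) (j : dhom X K (-1)) (s : dhom X S (- 1))
      (hs : is_dgshift s) (q : dhom K X 1) (r : dhom K Y 0),
    cocycle f -> is_dgcone f i j ->
    cocycle q -> dcomp (add0r 1) f q + ddiff (add0r 1) r = 0 ->
    coboundary (dcomp (addNr 1) j q + dcomp (addr0 0) i r - did K) ->
    dist (Triangle (H0mor f) (H0mor i)
                   (isohom (H0_sh hs) ∘ H0mor (dcomp (addNr 1) s q))) }.

Record gaction (k : fieldType) (gT : finGroupType) (D : tricat k) := GAction {
  gfun :> gT -> functor D D;
  act_equiv : forall g, is_equivalence (gfun g);
  act_exact : forall g, exact_functor (gfun g);
  eps : forall g h u, (g * h)%g = u -> forall X, iso (gfun g (gfun h X)) (gfun u X);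
  eps_nat : forall g h u (e : (g * h)%g = u),
    natural (fun _ _ f => fmap (gfun g) (fmap (gfun h) f))
            (fun _ _ f => fmap (gfun u) f) (eps e);
  eps_assoc : forall g h l gh hl ghl
      (e1 : (g * h)%g = gh) (e2 : (h * l)%g = hl)
      (e3 : (gh * l)%g = ghl) (e4 : (g * hl)%g = ghl) X,
    isohom (eps e3 X) ∘ isohom (eps e1 (gfun l X))
    = isohom (eps e4 X) ∘ fmap (gfun g) (isohom (eps e2 X)) }.

Definition lifts (k : fieldType) (gT : finGroupType) (D : tricat k)
    (a : gaction gT D) (A : dgenhancement D) : Prop :=
  exists (b : dgaction gT A)
         (tau : forall g (X : A), iso (H0ob (b g X)) (a g (H0ob X))),
    (forall g (X Y : A) (f : dhom X Y 0), cocycle f ->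
       fmap (a g) (H0mor f) ∘ isohom (tau g X) =
       isohom (tau g Y) ∘ H0mor (dgmap (b g) f)) /\
    (forall g h u (e : (g * h)%g = u) (X : A),
       isohom (eps a e (H0ob X)) ∘ fmap (a g) (isohom (tau h X)) ∘ isohom (tau g (b h X))
       = isohom (tau u X) ∘ H0mor (dghom (dgeps b e X))).

Section Equivariant.
Variables (k : fieldType) (gT : finGroupType) (D : tricat k) (a : gaction gT D).

(* The objects of the equivariant category D^H, see [eqcat]. *)
Record linearised (H : {group gT}) := Linearised {
  eob : D;
  lam : forall g, g \in H -> iso eob (a g eob);
  lamM : forall g h (gH : g \in H) (hH : h \in H),
    isohom (eps a (erefl (g * h)%g) eob) ∘ fmap (a g) (isohom (lam hH)) ∘ isohom (lam gH)
    = isohom (lam (groupM gH hH)) }.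

Arguments lam {H} l {g} gH : rename.

(* The left action f |-> ^g f on Hom_D(E, F) *)
Definition conjm (H : {group gT}) (X Y : linearised H) g (gH : g \in H)
    (f : mor (eob X) (eob Y)) : mor (eob X) (eob Y) :=
  isoinv (lam Y gH) ∘ fmap (a g) f ∘ isohom (lam X gH).

Arguments conjm {H} X Y {g} gH f.

Definition invariantb (H : {group gT}) (X Y : linearised H) :
    {pred mor (eob X) (eob Y)} :=
  fun f => `[< forall g (gH : g \in H), conjm X Y gH f = f >].

Arguments invariantb {H} X Y _.

Lemma compDl (C : lincat k) (X Y Z : C) (f : mor X Y) (g g' : mor Y Z) :
  (g + g') ∘ f = g ∘ f + g' ∘ f.
Proof. by rewrite -[g in LHS]scale1r comp_linl scale1r. Qed.

Lemma compZl (C : lincat k) (X Y Z : C) (f : mor X Y) c (g : mor Y Z) :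
  (c *: g) ∘ f = c *: (g ∘ f).
Proof.
have h0 : (0 : mor Y Z) ∘ f = 0.
  by apply: (addIr (0 ∘ f)); rewrite -compDl !add0r.
by rewrite -[c *: g]addr0 comp_linl h0 addr0.
Qed.

Lemma conjm_lin (H : {group gT}) (X Y : linearised H) g (gH : g \in H) c f f' :
  conjm X Y gH (c *: f + f') = c *: conjm X Y gH f + conjm X Y gH f'.
Proof. by rewrite /conjm fmap_lin comp_linr comp_linl. Qed.

Fact invariantb_submod (H : {group gT}) (X Y : linearised H) :
  submod_closed (invariantb X Y).
Proof.
split=> [|c f f' /asboolP hf /asboolP hf']; apply/asboolP=> g gH.
  by have := @conjm_lin _ X Y g gH (-1) 0 0; rewrite !scaler0 !addr0 scaleN1r addNr.
by rewrite conjm_lin hf hf'.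
Qed.

HB.instance Definition _ (H : {group gT}) (X Y : linearised H) :=
  GRing.isSubmodClosed.Build k (mor (eob X) (eob Y)) (invariantb X Y)
    (invariantb_submod X Y).

Record eqhom (H : {group gT}) (X Y : linearised H) := EqHom {
  emor : mor (eob X) (eob Y);
  emorP : emor \in invariantb X Y }.

HB.instance Definition _ (H : {group gT}) (X Y : linearised H) :=
  [isSub for @emor H X Y].
HB.instance Definition _ (H : {group gT}) (X Y : linearised H) :=
  [Choice of eqhom X Y by <:].
HB.instance Definition _ (H : {group gT}) (X Y : linearised H) :=
  [SubChoice_isSubLmodule of eqhom X Y by <:].

Section EquivariantCategory.
Variable H : {group gT}.
Implicit Types X Y Z : linearised H.

Lemma emorE X Y (f : eqhom X Y) g (gH : g \in H) :
  fmap (a g) (emor f) ∘ isohom (lam X gH) = isohom (lam Y gH) ∘ emor f.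
Proof.
have /asboolP/(_ g gH) := emorP f; rewrite /conjm => {2}<-.
by rewrite !compmA isoVK comp1m.
Qed.

Lemma invariantbP X Y (f : mor (eob X) (eob Y)) :
  (forall g (gH : g \in H),
     fmap (a g) f ∘ isohom (lam X gH) = isohom (lam Y gH) ∘ f) ->
  f \in invariantb X Y.
Proof.
move=> hf; apply/asboolP=> g gH.
by rewrite /conjm -compmA hf compmA isoK comp1m.
Qed.

Fact eqid_subproof X : mid (eob X) \in invariantb X X.
Proof. by apply: invariantbP => g gH; rewrite fmap1 comp1m compm1. Qed.

Definition eqid X : eqhom X X := EqHom (eqid_subproof X).

Fact eqcomp_subproof X Y Z (g : eqhom Y Z) (f : eqhom X Y) :
  emor g ∘ emor f \in invariantb X Z.
Proof.
by apply: invariantbP => x xH; rewrite fmapM -compmA emorE !compmA emorE.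
Qed.

Definition eqcomp X Y Z (g : eqhom Y Z) (f : eqhom X Y) : eqhom X Z :=
  EqHom (eqcomp_subproof g f).

Program Definition eqcat : lincat k :=
  @LinCat k (linearised H) (fun X Y => eqhom X Y : lmodType k) eqid eqcomp
    _ _ _ _ _.
Next Obligation. by move=> X Y f; apply: val_inj; rewrite /= comp1m. Qed.
Next Obligation. by move=> X Y f; apply: val_inj; rewrite /= compm1. Qed.
Next Obligation. by move=> W X Y Z h g f; apply: val_inj; rewrite /= compmA. Qed.
Next Obligation.
by move=> X Y Z f c g g'; apply: val_inj; rewrite /= comp_linl.
Qed.
Next Obligation.
by move=> X Y Z g c f f'; apply: val_inj; rewrite /= comp_linr.
Qed.

End EquivariantCategory.

Section Restriction.
Variables (K H : {group gT}) (sHK : H \subset K).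

Definition res_ob (X : linearised K) : linearised H :=
  @Linearised H (eob X) (fun g gH => lam X (subsetP sHK g gH))
    (fun g h gH hH => etrans (lamM X _ _)
       (congr1 (fun e => isohom (lam X e)) (bool_irrelevance _ _))).

Fact res_subproof (X Y : linearised K) (f : eqhom X Y) :
  emor f \in invariantb (res_ob X) (res_ob Y).
Proof. by apply: invariantbP => g gH; rewrite /= emorE. Qed.

Program Definition res : functor (eqcat K) (eqcat H) :=
  @Functor k (eqcat K) (eqcat H) res_ob (fun X Y f => EqHom (res_subproof f))
    _ _ _.
Next Obligation. by move=> *; apply: val_inj. Qed.
Next Obligation. by move=> *; apply: val_inj. Qed.
Next Obligation. by move=> *; apply: val_inj. Qed.

End Restriction.

(* Restriction to the trivial group is [eob], under the identification of D^1
   with D. *)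

(* The linearisation of [E] obtained from an isomorphism with the object
   underlying [X]. *)
Section Transport.
Variables (H : {group gT}) (E : D) (X : linearised H) (phi : iso E (eob X)).

Definition act_iso g (Y Z : D) (e : iso Y Z) : iso (a g Y) (a g Z).
Proof.
by exists (fmap (a g) (isohom e)) (fmap (a g) (isoinv e));
  rewrite -fmapM ?isoK ?isoVK fmap1.
Defined.

Definition iso_sym (Y Z : D) (e : iso Y Z) : iso Z Y := Iso (isoVK e) (isoK e).

Definition iso_comp (W Y Z : D) (e' : iso Y Z) (e : iso W Y) : iso W Z.
Proof.
exists (isohom e' ∘ isohom e) (isoinv e ∘ isoinv e').
  by rewrite compmA -(compmA _ (isoinv e')) isoK compm1 isoK.
by rewrite compmA -(compmA _ (isohom e)) isoVK compm1 isoVK.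
Defined.

Definition transport_lam g (gH : g \in H) : iso E (a g E) :=
  iso_comp (act_iso g (iso_sym phi)) (iso_comp (lam X gH) phi).

Fact transport_lamM g h (gH : g \in H) (hH : h \in H) :
  isohom (eps a (erefl (g * h)%g) E)
    ∘ fmap (a g) (isohom (transport_lam hH)) ∘ isohom (transport_lam gH)
  = isohom (transport_lam (groupM gH hH)).
Proof.
have nat := eps_nat a (erefl (g * h)%g) (isoinv phi).
rewrite /= -(lamM X gH hH) !fmapM !compmA -nat -!compmA.
do 3!congr (_ ∘ _); rewrite !compmA.
by rewrite -fmapM isoVK fmap1 comp1m.
Qed.

Definition transport : linearised H := Linearised transport_lamM.

End Transport.
End Equivariant.

Arguments lam {k gT D a H} l {g} gH : rename.
Arguments conjm {k gT D a H} X Y {g} gH f.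
Arguments transport {k gT D a H E X} phi.
Arguments eqcat {k gT D} a H.
Arguments res {k gT D} a {K H} sHK.

(* The induction functor Ind_H^G, G being the whole group: a left and right
   adjoint of the restriction functor Res_G^H. *)
Record induction_functor (k : fieldType) (gT : finGroupType) (D : tricat k)
    (a : gaction gT D) (H : {group gT}) := Induction {
  ind :> functor (eqcat a H) (eqcat a [set: gT]);
  ind_left : adjoint ind (res a (subsetT H));
  ind_right : adjoint (res a (subsetT H)) ind }.

(* MathComp's matrix representations gfun on row vectors from the right, i.e.
   they are right representations. *)

(* The [rho i] represent the isomorphism classes of irreducible
   representations of [H], each exactly once. *)
Definition irr_representatives (k : fieldType) (gT : finGroupType)
    (H : {group gT}) (I : finType) (deg : I -> nat)
    (rho : forall i, mx_representation k H (deg i)) : Prop :=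
  [/\ forall i, mx_irreducible (rho i),
      forall i j, mx_rsim (rho i) (rho j) -> i = j
    & forall d (r : mx_representation k H d), mx_irreducible r ->
        exists i, mx_rsim r (rho i)].

(* [T] is rho ⊗ X: for the standard basis v_b of V = k^d, [inj b] is the
   inclusion of v_b ⊗ X in V ⊗ X, and the linearisation maps v_b ⊗ x to
   v_b rho(g) ⊗ lam_g(x). *)
Definition is_rep_tensor (k : fieldType) (gT : finGroupType) (D : tricat k)
    (a : gaction gT D) (H : {group gT}) d (rho : mx_representation k H d)
    (X T : eqcat a H) : Prop :=
  exists inj : 'I_d -> mor (eob X) (eob T),
    is_dsum inj /\
    (forall g (gH : g \in H) b,
       isohom (lam T gH) ∘ inj b =
       \sum_c rho g b c *: (fmap (a g) (inj c) ∘ isohom (lam X gH))).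

(* Unital associative algebras; unlike [algType], the zero algebra is
   allowed. *)
Record kalg (k : fieldType) := KAlg {
  asort :> lmodType k;
  amul : asort -> asort -> asort;
  aone : asort;
  amulA : associative amul;
  amul1l : left_id aone amul;
  amul1r : right_id aone amul;
  amul_linl : forall y c x x', amul (c *: x + x') y = c *: amul x y + amul x' y;
  amul_linr : forall x c y y', amul x (c *: y + y') = c *: amul x y + amul x y' }.

Arguments amul {k A} x y : rename.
Arguments aone {k} A : rename.

Section Algebras.
Variable k : fieldType.
Implicit Types A B : kalg k.

Definition alg_isomorphic A B : Prop :=
  exists f : A -> B,
    [/\ bijective f, forall c x y, f (c *: x + y) = c *: f x + f y,
        f (aone A) = aone B & forall x y, f (amul x y) = amul (f x) (f y)].

Definition endalg (C : lincat k) (X : C) : kalg k :=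
  @KAlg k (mor X X) (fun f g => f ∘ g) (mid X) (@compmA k C X X X X)
    (@comp1m k C X X) (@compm1 k C X X) (@comp_linl k C X X X)
    (@comp_linr k C X X X).

Record alg_raction (gT : finGroupType) A := AlgRAction {
  raut : A -> gT -> A;
  ract_lin : forall g c x y, raut (c *: x + y) g = c *: raut x g + raut y g;
  ractM : forall g x y, raut (amul x y) g = amul (raut x g) (raut y g);
  ract1 : forall g, raut (aone A) g = aone A;
  ract_id : forall x, raut x 1%g = x;
  ract_comp : forall g h x, raut x (g * h)%g = raut (raut x g) h }.

(* Skew group algebra: an element of k<G> ⊗ A is given by its coefficients in
   A along the basis G of k<G>, i.e. the pure tensor (g, a) is the function
   with value a at g and 0 elsewhere; the product extends
   (g, a)(h, b) = (gh, a^h b), see [skew_mul_tensor]. *)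
Section Skew.
Variables (gT : finGroupType) (A : kalg k) (r : alg_raction gT A).
Implicit Types x y z : {ffun gT -> A}.

Definition skew_tensor (g : gT) (x : A) : {ffun gT -> A} :=
  [ffun u => if u == g then x else 0].

Definition skew_mul x y : {ffun gT -> A} :=
  [ffun u => \sum_h amul (raut r (x (u * h^-1)%g) h) (y h)].

Lemma amul0l (x : A) : amul 0 x = 0.
Proof.
by have := amul_linl x (-1) 0 0; rewrite !scaler0 !addr0 scaleN1r addNr.
Qed.

Lemma amul0r (x : A) : amul x 0 = 0.
Proof.
by have := amul_linr x (-1) 0 0; rewrite !scaler0 !addr0 scaleN1r addNr.
Qed.

Lemma amul_suml (I : finType) (F : I -> A) (y : A) :
  amul (\sum_i F i) y = \sum_i amul (F i) y.
Proof.
apply: (big_morph (amul^~ y)) => [x x'|]; last exact: amul0l.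
by rewrite -[x in LHS]scale1r amul_linl scale1r.
Qed.

Lemma amul_sumr (I : finType) (F : I -> A) (x : A) :
  amul x (\sum_i F i) = \sum_i amul x (F i).
Proof.
apply: (big_morph (amul x)) => [y y'|]; last exact: amul0r.
by rewrite -[y in LHS]scale1r amul_linr scale1r.
Qed.

Lemma ract0 g : raut r 0 g = 0.
Proof.
by have := ract_lin r g (-1) 0 0; rewrite !scaler0 !addr0 scaleN1r addNr.
Qed.

Lemma ract_sum (I : finType) (F : I -> A) g :
  raut r (\sum_i F i) g = \sum_i raut r (F i) g.
Proof.
have hD : {morph (fun x : A => raut r x g) : b c / b + c}.
  by move=> b c; rewrite -[b in LHS]scale1r ract_lin scale1r.
exact: (big_morph _ hD (ract0 g)).
Qed.

Lemma skew_mul_tensor g h (x y : A) :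
  skew_mul (skew_tensor g x) (skew_tensor h y)
  = skew_tensor (g * h)%g (amul (raut r x h) y).
Proof.
apply/ffunP=> u; rewrite !ffunE (bigD1 h) //= big1 ?addr0 => [|l /negPf nlh].
  rewrite !ffunE eqxx -(can2_eq (mulgKV h) (mulgK h)).
  by case: ifP => // _; rewrite ract0 amul0l.
by rewrite !ffunE nlh amul0r.
Qed.

Fact skew_mulA : associative skew_mul.
Proof.
move=> x y z; apply/ffunP=> u; rewrite !ffunE.
under eq_bigr => h _ do rewrite ffunE amul_sumr.
rewrite exchange_big /=; apply: eq_bigr => l _.
rewrite ffunE ract_sum amul_suml (reindex_inj (mulIg l)) /=.
apply: eq_bigr => h _.
by rewrite mulgK invMg mulgA ractM -ract_comp amulA.
Qed.

Fact skew_mul1l : left_id (skew_tensor 1 (aone A)) skew_mul.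
Proof.
move=> x; apply/ffunP=> u; rewrite ffunE (bigD1 u) //= big1 => [|h nhu].
  by rewrite addr0 ffunE mulgV eqxx ract1 amul1l.
rewrite ffunE ifN ?ract0 ?amul0l //.
by apply: contraNneq nhu => /eqP; rewrite -eq_mulgV1 eq_sym.
Qed.

Fact skew_mul1r : right_id (skew_tensor 1 (aone A)) skew_mul.
Proof.
move=> x; apply/ffunP=> u; rewrite ffunE (bigD1 1%g) //= big1 => [|h nh1].
  by rewrite addr0 ffunE eqxx invg1 mulg1 ract_id amul1r.
by rewrite ffunE (negPf nh1) amul0r.
Qed.

Fact skew_mul_linl y c x x' :
  skew_mul (c *: x + x') y = c *: skew_mul x y + skew_mul x' y.
Proof.
apply/ffunP=> u; rewrite !ffunE scaler_sumr -big_split /=.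
by apply: eq_bigr => h _; rewrite !ffunE ract_lin amul_linl.
Qed.

Fact skew_mul_linr x c y y' :
  skew_mul x (c *: y + y') = c *: skew_mul x y + skew_mul x y'.
Proof.
apply/ffunP=> u; rewrite !ffunE scaler_sumr -big_split /=.
by apply: eq_bigr => h _; rewrite !ffunE amul_linr.
Qed.

Definition skew_alg : kalg k :=
  KAlg skew_mulA skew_mul1l skew_mul1r skew_mul_linl skew_mul_linr.

End Skew.
End Algebras.

Section Modules.
Variables (k : fieldType) (A : kalg k).

Record rmod := RMod {
  msort :> lmodType k;
  mscale : msort -> A -> msort;
  mact_linl : forall x c m m', mscale (c *: m + m') x = c *: mscale m x + mscale m' x;
  mact_linr : forall m c x x', mscale m (c *: x + x') = c *: mscale m x + mscale m x';
  mact1 : forall m, mscale m (aone A) = m;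
  mactM : forall m x y, mscale m (amul x y) = mscale (mscale m x) y }.

Definition modhomb (M N : rmod) : {pred M -> N} :=
  fun f => `[< (forall c m m', f (c *: m + m') = c *: f m + f m') /\
               (forall m x, f (mscale m x) = mscale (f m) x) >].

Lemma mact0 (M : rmod) x : mscale (0 : M) x = 0.
Proof.
by have := mact_linl x (-1) (0 : M) 0; rewrite !scaler0 !addr0 scaleN1r addNr.
Qed.

Fact modhomb_submod (M N : rmod) : submod_closed (@modhomb M N).
Proof.
split=> [|c f g /asboolP[f1 f2] /asboolP[g1 g2]]; apply/asboolP.
  by split=> [d m m'|m x]; rewrite ?scaler0 ?addr0 ?mact0.
split=> [d m m'|m x].
  rewrite !fctE f1 g1 !scalerDr !scalerA [c * d]mulrC -!addrA; congr (_ + _).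
  by rewrite addrCA.
by rewrite !fctE f2 g2 mact_linl.
Qed.

HB.instance Definition _ (M N : rmod) :=
  GRing.isSubmodClosed.Build k (M -> N) (@modhomb M N) (@modhomb_submod M N).

Record modhom (M N : rmod) := ModHom {
  mmor : M -> N;
  mmorP : mmor \in @modhomb M N }.

HB.instance Definition _ (M N : rmod) := [isSub for @mmor M N].
HB.instance Definition _ (M N : rmod) := [Choice of modhom M N by <:].
HB.instance Definition _ (M N : rmod) :=
  [SubChoice_isSubLmodule of modhom M N by <:].

Fact modid_subproof (M : rmod) : id \in @modhomb M M.
Proof. exact/asboolP. Qed.

Fact modcomp_subproof (M N P : rmod) (g : modhom N P) (f : modhom M N) :
  mmor g \o mmor f \in @modhomb M P.
Proof.
have /asboolP[g1 g2] := mmorP g; have /asboolP[f1 f2] := mmorP f.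
by apply/asboolP; split=> *; rewrite /= ?f1 ?g1 ?f2 ?g2.
Qed.

Program Definition modcat : lincat k :=
  @LinCat k rmod (fun M N => modhom M N : lmodType k)
    (fun M => ModHom (modid_subproof M))
    (fun M N P g f => ModHom (modcomp_subproof g f)) _ _ _ _ _.
Next Obligation. by move=> M N f; apply: val_inj. Qed.
Next Obligation. by move=> M N f; apply: val_inj. Qed.
Next Obligation. by move=> W X Y Z h g f; apply: val_inj. Qed.
Next Obligation. by move=> X Y Z f c g g'; apply: val_inj. Qed.
Next Obligation.
move=> X Y Z g c f f'; apply: val_inj; rewrite /=.
by have /asboolP[g1 _] := mmorP g; apply/funext => x; rewrite /= !fctE g1.
Qed.

Definition regmod : modcat :=
  @RMod A (@amul k A) (@amul_linl k A) (@amul_linr k A) (@amul1r k A)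
    (fun m x y => @amulA k A m x y).

(* By the Krull-Remak-Schmidt theorem the indecomposable summands of [regmod]
   do not depend on the decomposition, up to isomorphism and order. *)
Definition basic : Prop :=
  fin_dim A /\
  exists n (P : 'I_n -> modcat) (inj : forall i, mor (P i) regmod),
    [/\ is_dsum inj, forall i, indecomposable (P i)
      & forall i j, isomorphic (P i) (P j) -> i = j].

End Modules.

Definition morita_equivalent (k : fieldType) (A B : kalg k) : Prop :=
  exists F : functor (modcat A) (modcat B), is_equivalence F.

(* [B] is (a representative of) A^b, which is defined up to isomorphism. *)
Definition is_basic_reduction (k : fieldType) (A B : kalg k) : Prop :=
  basic B /\ morita_equivalent A B.

Section EndAction.
Variables (k : fieldType) (gT : finGroupType) (D : tricat k) (a : gaction gT D).

Lemma conjm_comp (H : {group gT}) (X Y : linearised a H) g h u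
    (gH : g \in H) (hH : h \in H) (uH : u \in H) (f : mor (eob X) (eob Y)) :
  (g * h)%g = u -> conjm X Y gH (conjm X Y hH f) = conjm X Y uH f.
Proof.
move=> e; case: u / e uH => uH; rewrite (bool_irrelevance uH (groupM gH hH)).
have nat := eps_nat a (erefl (g * h)%g) f.
have lamK (Z : linearised a H) : isoinv (lam Z (groupM gH hH)) ∘
    (isohom (eps a (erefl (g * h)%g) (eob Z)) ∘ fmap (a g) (isohom (lam Z hH)) ∘
     isohom (lam Z gH)) = mid (eob Z) by rewrite lamM isoK.
rewrite -[LHS]comp1m -(lamK Y) [RHS]/conjm -(lamM X gH hH).
rewrite -!compmA; congr (_ ∘ _).
rewrite [RHS]compmA nat -!compmA; congr (_ ∘ _).
rewrite /conjm !compmA -(compmA _ (isohom (lam Y gH))) isoVK compm1.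
by rewrite !fmapM !compmA -fmapM isoVK fmap1 comp1m.
Qed.

Variable X : linearised a [set: gT].

(* f^g = ^(g^-1) f *)
Definition end_ract (f : endalg (eob X)) (g : gT) : endalg (eob X) :=
  conjm X X (in_setT g^-1%g) f.

Fact end_ract_lin g c f f' :
  end_ract (c *: f + f') g = c *: end_ract f g + end_ract f' g.
Proof. exact: conjm_lin. Qed.

Fact end_ractM g f f' :
  end_ract (amul f f') g = amul (end_ract f g) (end_ract f' g).
Proof.
rewrite /end_ract /conjm /= fmapM -!compmA; do 2!congr (_ ∘ _).
by rewrite !compmA isoVK comp1m.
Qed.

Fact end_ract1 g : end_ract (aone (endalg (eob X))) g = aone (endalg (eob X)).
Proof. by rewrite /end_ract /conjm /= fmap1 compm1 isoK. Qed.

Fact end_ract_comp g h f : end_ract f (g * h)%g = end_ract (end_ract f g) h.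
Proof. by apply/esym/conjm_comp; rewrite invMg. Qed.

Fact end_ract_id f : end_ract f 1%g = f.
Proof.
have ract_inj : injective (fun f => end_ract f 1%g).
  move=> f1 f2 e; have [/(_ (eob X) (eob X))/bij_inj inj _] := act_equiv a 1^-1%g.
  apply: inj; move/(congr1 (fun f => isohom (lam X (in_setT 1^-1%g)) ∘ f ∘
                                     isoinv (lam X (in_setT 1^-1%g)))): e.
  rewrite /end_ract /conjm !compmA isoVK !comp1m.
  by rewrite -!(compmA _ _ (isoinv _)) isoVK !compm1.
by apply: ract_inj; rewrite -end_ract_comp mulg1.
Qed.

Definition end_action : alg_raction gT (endalg (eob X)) :=
  AlgRAction end_ract_lin end_ractM end_ract1 end_ract_id end_ract_comp.

End EndAction.

(* Main.v *)
(* Let [Q] in [D^G] be the object freely generated by the object [EE] of [D], so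
   that [Q] is the direct sum of the translates of [EE] with the linearisation
   permuting them. As [EE] is linearised, [Q] is also the tensor product of the
   regular representation with [EE], and [End(Q)] is the skew group algebra.
   Since [|G|] is invertible, averaging shows that [Q] is a summand of a multiple
   of [FF] (the matrix coefficients of the irreducible representations of [H_i]
   span the function supported at [1], by Maschke) and that [FF] is a summand of
   a multiple of [Q]; hence [End(FF)] and [End(Q)] are Morita equivalent.
   Semiorthogonality forces [Hom(E_{i,1}, E_{i,j}) = 0] for [j <> 1], so that
   every morphism between the [Ind(rho ⊗ calE_i)] with the same [i] is induced
   from an intertwiner: by Schur's lemma the summands of [FF] have only trivial
   idempotents and are pairwise non-isomorphic, i.e. [End(FF)] is basic. *)

Require Import Defs.
From mathcomp Require Import all_boot all_order all_algebra all_fingroup.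
From mathcomp Require Import pgroup mxrepresentation.
From mathcomp Require Import boolp functions.

Set Implicit Arguments.
Unset Strict Implicit.
Unset Printing Implicit Defensive.

Import GRing.Theory.
Local Open Scope ring_scope.
Local Open Scope cat_scope.
#[local] Obligation Tactic := idtac.

(** * Composition and functors in linear categories *)

Section LinearCategories.
Variable k : fieldType.
Implicit Types C D : lincat k.

Lemma comp0m C (X Y Z : C) (f : mor X Y) : (0 : mor Y Z) ∘ f = 0.
Proof. by rewrite -[X in X ∘ f](scale0r (0 : mor Y Z)) compZl scale0r. Qed.

Lemma compDr C (X Y Z : C) (g : mor Y Z) (f f' : mor X Y) :
  g ∘ (f + f') = g ∘ f + g ∘ f'.
Proof. by rewrite -[f in LHS]scale1r comp_linr scale1r. Qed.

Lemma compm0 C (X Y Z : C) (g : mor Y Z) : g ∘ (0 : mor X Y) = 0.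
Proof. by apply: (addIr (g ∘ (0 : mor X Y))); rewrite -compDr !add0r. Qed.

Lemma compZr C (X Y Z : C) (g : mor Y Z) c (f : mor X Y) :
  g ∘ (c *: f) = c *: (g ∘ f).
Proof. by rewrite -[c *: f]addr0 comp_linr compm0 addr0. Qed.

Lemma comp_suml C (X Y Z : C) I (r : seq I) (P : pred I) (F : I -> mor Y Z)
    (f : mor X Y) :
  (\sum_(i <- r | P i) F i) ∘ f = \sum_(i <- r | P i) F i ∘ f.
Proof.
apply: (big_morph (fun g => g ∘ f)) => [g g'|]; first exact: compDl.
exact: comp0m.
Qed.

Lemma comp_sumr C (X Y Z : C) I (r : seq I) (P : pred I) (F : I -> mor X Y)
    (g : mor Y Z) :
  g ∘ (\sum_(i <- r | P i) F i) = \sum_(i <- r | P i) g ∘ F i.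
Proof.
apply: (big_morph (mcomp g)) => [f f'|]; first exact: compDr.
exact: compm0.
Qed.

Lemma fmapD C D (F : functor C D) X Y (f g : mor X Y) :
  fmap F (f + g) = fmap F f + fmap F g.
Proof. by rewrite -[f in LHS]scale1r fmap_lin scale1r. Qed.

Lemma fmap0 C D (F : functor C D) (X Y : C) : fmap F (0 : mor X Y) = 0.
Proof. by apply: (addIr (fmap F (0 : mor X Y))); rewrite -fmapD !add0r. Qed.

Lemma fmapZ C D (F : functor C D) X Y c (f : mor X Y) :
  fmap F (c *: f) = c *: fmap F f.
Proof. by rewrite -[c *: f]addr0 fmap_lin fmap0 addr0. Qed.

Lemma fmap_sum C D (F : functor C D) X Y I (r : seq I) (P : pred I)
    (f : I -> mor X Y) :
  fmap F (\sum_(i <- r | P i) f i) = \sum_(i <- r | P i) fmap F (f i).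
Proof.
apply: (big_morph (fmap F)) => [g g'|]; [exact: fmapD | exact: fmap0].
Qed.

Lemma inj_surj_bij (T T' : Type) (f : T -> T') :
  injective f -> (forall y, exists x, f x = y) -> bijective f.
Proof.
move=> inj /choice[g fgK]; exists g => // x.
by apply: inj; rewrite fgK.
Qed.

Lemma comp_cancell C (X Y Z : C) (f : mor Y Z) (g : mor Z Y) (u : mor X Y) :
  g ∘ f = mid Y -> g ∘ (f ∘ u) = u.
Proof. by move=> gf; rewrite compmA gf comp1m. Qed.

Lemma comp_cancelr C (X Y Z : C) (f : mor X Y) (g : mor Y X) (u : mor X Z) :
  g ∘ f = mid X -> u ∘ g ∘ f = u.
Proof. by move=> gf; rewrite -compmA gf compm1. Qed.

Lemma equivalence_comp (C1 C2 C3 : lincat k) (F : functor C1 C2)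
    (G : functor C2 C3) : is_equivalence F -> is_equivalence G ->
  exists GF : functor C1 C3, is_equivalence GF.
Proof.
move=> [Fff Fes] [Gff Ges].
have lin X Y c (f g : mor X Y) :
    fmap G (fmap F (c *: f + g)) = c *: fmap G (fmap F f) + fmap G (fmap F g).
  by rewrite !fmap_lin.
have id1 X : fmap G (fmap F (mid X)) = mid (G (F X)) by rewrite !fmap1.
have comp X Y Z (g : mor Y Z) (f : mor X Y) :
    fmap G (fmap F (g ∘ f)) = fmap G (fmap F g) ∘ fmap G (fmap F f).
  by rewrite !fmapM.
exists (@Functor k C1 C3 (fun X => G (F X)) (fun X Y f => fmap G (fmap F f))
  lin id1 comp).
split=> [X Y | Z]; first exact: bij_comp (Gff _ _) (Fff _ _).
have [Y [[u v vu uv]]] := Ges Z; have [X [[f g gf fg]]] := Fes Y.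
exists X; split; exists (u ∘ fmap G f) (fmap G g ∘ v).
  by rewrite -compmA (comp_cancell _ vu) -fmapM gf fmap1.
by rewrite -compmA (compmA (fmap G f)) -fmapM fg fmap1 comp1m uv.
Qed.

(** * Finite direct sums *)

(** The universal property applied to Kronecker families gives the projections; its uniqueness
    clause identifies the sum of the [inj i ∘ pr i] with the identity. *)
Lemma dsum_proj C (I : finType) (X : I -> C) P (inj : forall i, mor (X i) P) :
  is_dsum inj -> exists pr : forall i, mor P (X i),
    [/\ forall i, pr i ∘ inj i = mid (X i),
        forall i j, i != j -> pr i ∘ inj j = 0
      & \sum_i inj i ∘ pr i = mid P].
Proof.
move=> sumP.
pose d i j : mor (X j) (X i) :=
  if j =P i is ReflectT e then ecast i (mor (X j) (X i)) e (mid (X j)) else 0.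
have d1 i : d i i = mid (X i).
  by rewrite /d; case: eqP => // e; rewrite eq_axiomK.
have d0 i j : i != j -> d i j = 0.
  by move=> ij; rewrite /d; case: eqP => // e; rewrite e eqxx in ij.
have prP i : {u : mor P (X i) | forall j, u ∘ inj j = d i j}.
  by apply: cid; have [u [uE _]] := sumP _ (d i); exists u.
pose pr i := sval (prP i); have prE i := svalP (prP i) : forall j, pr i ∘ inj j = _.
exists pr; split=> [i|i j ij|]; rewrite ?prE ?d1 ?d0 //.
have [u [_ uniq]] := sumP _ inj.
rewrite -(uniq (mid P)) => [|i]; last by rewrite comp1m.
apply/esym/uniq => j; rewrite comp_suml (bigD1 j) //= -compmA prE d1 compm1.
by rewrite big1 ?addr0 // => i ij; rewrite -compmA prE d0 // compm0.
Qed.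

Lemma dsum_of_proj C (I : finType) (X : I -> C) P (inj : forall i, mor (X i) P)
    (pr : forall i, mor P (X i)) :
  (forall i, pr i ∘ inj i = mid (X i)) ->
  (forall i j, i != j -> pr i ∘ inj j = 0) ->
  \sum_i inj i ∘ pr i = mid P -> is_dsum inj.
Proof.
move=> pr1 pr0 prS Y f; exists (\sum_i f i ∘ pr i); split=> [j|v vE].
  rewrite comp_suml (bigD1 j) //= -compmA pr1 compm1 big1 ?addr0 // => i ij.
  by rewrite -compmA pr0 // compm0.
rewrite -[v]compm1 -prS comp_sumr; apply: eq_bigr => i _.
by rewrite compmA vE.
Qed.

Lemma dsum_eq C (I : small) (X : I -> C) P (inj : forall i, mor (X i) P) Y
    (u v : mor P Y) :
  is_dsum inj -> (forall i, u ∘ inj i = v ∘ inj i) -> u = v.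
Proof.
move=> sumP uv; have [w [_ uniq]] := sumP Y (fun i => v ∘ inj i).
by rewrite -(uniq u uv) -(uniq v).
Qed.

(** * Morphisms factoring through finite sums of copies of an object *)

(** When finite direct sums exist, this means that [f] factors through a finite multiple of [Z]; for
    [f = mid X], that [X] is a retract of such a multiple. *)
Definition through C (Z X Y : C) (f : mor X Y) : Prop :=
  exists s : seq (mor X Z * mor Z Y), f = \sum_(pq <- s) pq.2 ∘ pq.1.

Lemma through_comp C (Z X Y : C) (p : mor X Z) (q : mor Z Y) : through Z (q ∘ p).
Proof. by exists [:: (p, q)]; rewrite big_seq1. Qed.

Lemma through_sum C (Z X Y : C) I (r : seq I) (P : pred I) (F : I -> mor X Y) :
  (forall i, P i -> through Z (F i)) -> through Z (\sum_(i <- r | P i) F i).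
Proof.
move=> FZ; apply: big_ind => //; first by exists [::]; rewrite big_nil.
by move=> _ _ [s ->] [t ->]; exists (s ++ t); rewrite big_cat.
Qed.

Lemma through_sandwich C (Z W X Y V : C) (g : mor Y V) (f : mor X Y)
    (h : mor W X) : through Z f -> through Z (g ∘ f ∘ h).
Proof.
move=> [s ->]; rewrite comp_sumr comp_suml; apply: through_sum => pq _.
by rewrite compmA -compmA; apply: through_comp.
Qed.

Lemma throughZ C (Z X Y : C) c (f : mor X Y) : through Z f -> through Z (c *: f).
Proof.
move=> [s ->]; exists [seq (pq.1, c *: pq.2) | pq <- s].
by rewrite big_map scaler_sumr; apply: eq_bigr => pq _; rewrite /= compZl.
Qed.

Lemma through_trans C (Y Z X V : C) (f : mor X V) :
  through Z (mid Y) -> through Y f -> through Z f.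
Proof.
move=> YZ [s ->]; apply: through_sum => pq _.
by rewrite -[pq.2]compm1; apply: through_sandwich.
Qed.

End LinearCategories.
(** * Morita equivalence of endomorphism algebras *)

Section Modules.
Variables (k : fieldType) (A : kalg k).
Implicit Types M N : rmod A.

Lemma mmor_lin M N (u : modhom M N) c x y : mmor u (c *: x + y) = c *: mmor u x + mmor u y.
Proof. by have /asboolP[] := mmorP u. Qed.

Lemma mmor_act M N (u : modhom M N) x b : mmor u (mscale x b) = mscale (mmor u x) b.
Proof. by have /asboolP[] := mmorP u. Qed.

Lemma mmorD M N (u : modhom M N) x y : mmor u (x + y) = mmor u x + mmor u y.
Proof. by rewrite -[x in LHS]scale1r mmor_lin scale1r. Qed.

Lemma mmor0 M N (u : modhom M N) : mmor u 0 = 0.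
Proof. by apply: (addIr (mmor u 0)); rewrite -mmorD !add0r. Qed.

Lemma mmor_sum M N (u : modhom M N) I (r : seq I) (F : I -> M) :
  mmor u (\sum_(i <- r) F i) = \sum_(i <- r) mmor u (F i).
Proof. exact: (big_morph (mmor u) (mmorD u) (mmor0 u)). Qed.

Lemma msum_apply M N I (r : seq I) (u : I -> modhom M N) x :
  mmor (\sum_(i <- r) u i) x = \sum_(i <- r) mmor (u i) x.
Proof. exact: (big_morph (fun v : modhom M N => mmor v x)). Qed.

Lemma mactD M (x : M) b c : mscale x (b + c) = mscale x b + mscale x c.
Proof. by rewrite -[b in LHS]scale1r mact_linr scale1r. Qed.

Lemma mact_0r M (x : M) : mscale x 0 = 0.
Proof. by apply: (addIr (mscale x 0)); rewrite -mactD !add0r. Qed.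

Lemma mact_sumr M (x : M) I (r : seq I) (F : I -> A) :
  mscale x (\sum_(i <- r) F i) = \sum_(i <- r) mscale x (F i).
Proof. exact: (big_morph (mscale x) (mactD x) (mact_0r x)). Qed.

Lemma mact_suml M (b : A) I (r : seq I) (F : I -> M) :
  mscale (\sum_(i <- r) F i) b = \sum_(i <- r) mscale (F i) b.
Proof.
apply: (big_morph (fun x => mscale x b)) => [x y|]; last exact: mact0.
by rewrite -[x in LHS]scale1r mact_linl scale1r.
Qed.

Lemma modhom_eq M N (u v : modhom M N) : (forall x, mmor u x = mmor v x) -> u = v.
Proof. by move=> uv; apply/val_inj/funext. Qed.

Definition mkmodhom M N (f : M -> N)
    (f_lin : forall c x y, f (c *: x + y) = c *: f x + f y)
    (f_act : forall x b, f (mscale x b) = mscale (f x) b) : modhom M N :=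
  ModHom (introT (asboolP _) (conj f_lin f_act)).

End Modules.

Section HomModules.
Variables (k : fieldType) (C : lincat k).
Implicit Types X Y Z : C.

(** [homod X X] is convertible to the regular right module of [endalg X]. *)
Definition homod X Y : rmod (endalg X) :=
  @RMod k (endalg X) (mor X Y) (fun f x => f ∘ x)
    (fun x c f g => comp_linl x c f g) (fun f c x y => comp_linr f c x y)
    (@compm1 k C X Y) (fun f x y => @compmA k C X X X Y f x y).

Lemma homod_comp X Y (M : rmod (endalg X)) (u : modhom (homod X Y) M)
    (f : mor X Y) (b : mor X X) : mmor u (f ∘ b) = mscale (mmor u f) b.
Proof. exact: (mmor_act u). Qed.

Section HomFunctor.
Variables X Z : C.

Definition precomp (M : rmod (endalg X)) (u : modhom (homod X Z) M)
  (b : endalg Z) : modhom (homod X Z) M.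
Proof.
apply: (@mkmodhom _ _ (homod X Z) M (fun f : mor X Z => mmor u (b ∘ f))).
  by move=> c f g; rewrite comp_linr (mmor_lin u).
by move=> f x; rewrite /= compmA homod_comp.
Defined.

(** The value at [M] of the functor Hom(Hom(X, Z), -) over End(X); the right action of End(Z) comes
    from its left action on Hom(X, Z). *)
Program Definition homfun_ob (M : rmod (endalg X)) : rmod (endalg Z) :=
  @RMod k (endalg Z) (modhom (homod X Z) M : lmodType k) (@precomp M) _ _ _ _.
Next Obligation. by move=> M b c u v; apply: modhom_eq. Qed.
Next Obligation.
move=> M u c b b'; apply: modhom_eq => f /=.
by rewrite comp_linl (mmor_lin u).
Qed.
Next Obligation. by move=> M u; apply: modhom_eq => f /=; rewrite comp1m. Qed.
Next Obligation. by move=> M u b b'; apply: modhom_eq => f /=; rewrite compmA. Qed.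

Definition homfun_mor M N (v : modhom M N) : modhom (homfun_ob M) (homfun_ob N).
Proof.
apply: (@mkmodhom _ _ (homfun_ob M) (homfun_ob N)
  (fun u => ModHom (modcomp_subproof v u))).
  by move=> c u u'; apply: modhom_eq => f; rewrite /= mmor_lin.
by move=> u b; apply: modhom_eq.
Defined.

Program Definition homfun : functor (modcat (endalg X)) (modcat (endalg Z)) :=
  @Functor k (modcat (endalg X)) (modcat (endalg Z)) homfun_ob homfun_mor _ _ _.
Next Obligation.
by move=> M N c u v; apply: modhom_eq => w; apply: modhom_eq.
Qed.
Next Obligation. by move=> M; apply: modhom_eq => w; apply: modhom_eq. Qed.
Next Obligation.
by move=> M N P u v; apply: modhom_eq => w; apply: modhom_eq.
Qed.

End HomFunctor.

Definition eval_hom X Z (M : rmod (endalg X)) (m : M) (q : mor Z X) :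
  modhom (homod X Z) M.
Proof.
apply: (@mkmodhom _ _ (homod X Z) M (fun f : mor X Z => mscale m (q ∘ f : endalg X))).
  by move=> c f g; rewrite comp_linr mact_linr.
by move=> f b; rewrite /= compmA -mactM.
Defined.

(* With [mid X = \sum q ∘ p], an element [m] of [M] is the sum of the values
   at [p] of the homomorphisms [f |-> m (q ∘ f)] in [homfun X Z M]; hence [M]
   can be recovered from [homfun X Z M]. *)
Lemma morita_through X Z :
  through Z (mid X) -> through X (mid Z) ->
  morita_equivalent (endalg X) (endalg Z).
Proof.
move=> [s sE] [t tE]; exists (homfun X Z); split=> [M N|N].
  have decomp (m : M) : m = \sum_(pq <- s) mmor (eval_hom m pq.2) pq.1.
    by rewrite -mact_sumr -sE mact1.
  apply: inj_surj_bij => [u v uv|w].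
    apply: modhom_eq => m; rewrite [m]decomp !mmor_sum; apply: eq_bigr => pq _.
    by have /(congr1 (fun w : modhom (homfun_ob Z M) (homfun_ob Z N) =>
      mmor (mmor w (eval_hom m pq.2)) pq.1)) := uv.
  (* The preimage of [w]: the formula is forced by [decomp]. *)
  pose f (m : M) : N := \sum_(pq <- s) mmor (mmor w (eval_hom m pq.2)) pq.1.
  have f_lin c x y : f (c *: x + y) = c *: f x + f y.
    rewrite /f scaler_sumr -big_split; apply: eq_bigr => pq _ /=.
    have -> : eval_hom (c *: x + y) pq.2 = c *: eval_hom x pq.2 + eval_hom y pq.2.
      by apply: modhom_eq => g; rewrite /= mact_linl.
    by rewrite mmor_lin.
  (* This says that [homfun] maps [f] to [w]. It rests on the End(Z)-linearity of [w], since
     [eval_hom (mmor u g) q] is [u] acted on by [g ∘ q]. *)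
  have w_comp (u : modhom (homod X Z) M) (g : mor X Z) :
      \sum_(pq <- s) mmor (mmor w (eval_hom (mmor u g) pq.2)) pq.1 = mmor (mmor w u) g.
    rewrite -[g in RHS]compm1 sE comp_sumr mmor_sum; apply: eq_bigr => pq _.
    have -> : eval_hom (mmor u g) pq.2 =
        mscale (u : homfun_ob Z M) (g ∘ pq.2 : endalg Z).
      by apply: modhom_eq => h /=; rewrite -compmA homod_comp.
    by rewrite mmor_act /= compmA.
  have f_act x b : f (mscale x b) = mscale (f x) b.
    rewrite {2}/f mact_suml.
    under [RHS]eq_bigr => pq _ do rewrite -homod_comp -w_comp.
    rewrite /f exchange_big /=; apply: eq_bigr => pq _.
    (* Inserting the decomposition of [mid X] before [b] writes [mscale x b] as the sum of the
       values of [eval_hom x i.2] at [i.1 ∘ b]. *)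
    have -> : eval_hom (mscale x b) pq.2 = \sum_(i <- s)
        eval_hom (mmor (eval_hom x i.2) (i.1 ∘ b)) pq.2 :> homfun_ob Z M.
      apply: modhom_eq => g; rewrite msum_apply /= -mactM.
      under eq_bigr => i _ do rewrite -mactM.
      rewrite -mact_sumr; congr (mscale x _) => /=.
      rewrite compmA -[b in LHS]comp1m sE !comp_suml; apply: eq_bigr => i _.
      by rewrite !compmA.
    by rewrite mmor_sum; apply: msum_apply.
  exists (mkmodhom f_lin f_act).
  by apply: modhom_eq => u; apply: modhom_eq => g; apply: w_comp.
(* Essential surjectivity: the preimage comes from the functor with [X] and [Z] exchanged. The map
   [g2] sends [n] to [f, h |-> n (f ∘ h)], and the decomposition of [mid Z] provides its inverse
   [e]. *)
exists (homfun_ob X N).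
pose T := homfun_ob Z (homfun_ob X N).
pose g1 (n : N) (f : mor X Z) : modhom (homod Z X) N := eval_hom n f.
have g2P (n : N) : (forall c x y, g1 n (c *: x + y) = c *: g1 n x + g1 n y) /\
    (forall f b, g1 n (mscale (f : homod X Z) b) = mscale (g1 n f : homfun_ob X N) b).
  split=> [c x y|f b]; apply: modhom_eq => h /=.
    by rewrite comp_linl mact_linr.
  by rewrite compmA.
pose g2 (n : N) : T := @mkmodhom _ _ (homod X Z) (homfun_ob X N) (g1 n) (g2P n).1 (g2P n).2.
have g2_lin c x y : g2 (c *: x + y) = c *: g2 x + g2 y.
  by apply: modhom_eq => f; apply: modhom_eq => h; rewrite /= mact_linl.
have g2_act x b : g2 (mscale x b) = mscale (g2 x) b.
  by apply: modhom_eq => f; apply: modhom_eq => h; rewrite /= -mactM /= compmA.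
pose e (y : T) : N := \sum_(pq <- t) mmor (mmor y pq.2) pq.1.
have e_lin c x y : e (c *: x + y) = c *: e x + e y.
  by rewrite /e scaler_sumr -big_split.
have e_g2 n : e (g2 n) = n.
  by rewrite -[RHS]mact1 /= tE mact_sumr; apply: eq_bigr.
have g2_e y : g2 (e y) = y.
  apply: modhom_eq => f; apply: modhom_eq => h /=.
  rewrite -[f in RHS]comp1m tE comp_suml mmor_sum msum_apply.
  rewrite mact_suml; apply: eq_bigr => pq _.
  rewrite -homod_comp -compmA [X in _ = mmor X _]homod_comp /=.
  by rewrite compmA.
have e_act y b : e (mscale y b) = mscale (e y) b.
  by rewrite -[RHS]e_g2 g2_act g2_e.
constructor; refine (@Iso k (modcat (endalg Z)) T N (mkmodhom e_lin e_act)
  (mkmodhom g2_lin g2_act) _ _).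
  by apply: (@modhom_eq _ _ T T) => y; apply: g2_e.
by apply: (@modhom_eq _ _ N N) => n; apply: e_g2.
Qed.

End HomModules.

(** * Restriction of scalars along an algebra isomorphism *)

Section Restriction.
Variables (k : fieldType) (A B : kalg k) (h : A -> B).
Hypotheses (h_lin : forall c x y, h (c *: x + y) = c *: h x + h y)
  (h1 : h (aone A) = aone B) (hM : forall x y, h (amul x y) = amul (h x) (h y)).

Program Definition restr_ob (M : rmod B) : rmod A :=
  @RMod k A M (fun m x => mscale m (h x)) _ _ _ _.
Next Obligation. by move=> *; rewrite /= mact_linl. Qed.
Next Obligation. by move=> *; rewrite /= h_lin mact_linr. Qed.
Next Obligation. by move=> *; rewrite /= h1 mact1. Qed.
Next Obligation. by move=> *; rewrite /= hM mactM. Qed.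

Definition restr_mor (M N : rmod B) (u : modhom M N) :
    modhom (restr_ob M) (restr_ob N) :=
  @mkmodhom _ _ (restr_ob M) (restr_ob N) (mmor u) (mmor_lin u)
    (fun m x => mmor_act u m (h x)).

Program Definition restr : functor (modcat B) (modcat A) :=
  @Functor k (modcat B) (modcat A) restr_ob restr_mor _ _ _.
Next Obligation. by move=> *; apply: modhom_eq. Qed.
Next Obligation. by move=> *; apply: modhom_eq. Qed.
Next Obligation. by move=> *; apply: modhom_eq. Qed.

(** The inverse of [h] is again an algebra homomorphism, so every [A]-module is the restriction of a
    [B]-module on the same space. *)
Lemma restr_equivalence : bijective h -> is_equivalence restr.
Proof.
case=> g hK gK; split=> [M N|N].
  apply: inj_surj_bij => [u v uv|u].
    apply: modhom_eq => m.
    by have /(congr1 (fun w : modhom (restr_ob M) (restr_ob N) => mmor w m)) := uv.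
  have u_act m x : mmor (u : modhom (restr_ob M) (restr_ob N)) (mscale (m : M) x)
      = mscale (mmor (u : modhom (restr_ob M) (restr_ob N)) m : N) x.
    by have := mmor_act (u : modhom (restr_ob M) (restr_ob N)) m (g x); rewrite /= gK.
  exists (@mkmodhom _ _ M N (mmor u) (mmor_lin (u : modhom (restr_ob M) (restr_ob N))) u_act).
  exact: modhom_eq.
have g_lin c x y : g (c *: x + y) = c *: g x + g y.
  by apply: (can_inj hK); rewrite h_lin !gK.
have g1 : g (aone B) = aone A by rewrite -h1 hK.
have gM x y : g (amul x y) = amul (g x) (g y).
  by apply: (can_inj hK); rewrite hM !gK.
unshelve eexists (@RMod k B N (fun m x => mscale m (g x)) _ _ _ _).
- by move=> *; rewrite /= mact_linl.
- by move=> *; rewrite /= g_lin mact_linr.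
- by move=> *; rewrite /= g1 mact1.
- by move=> *; rewrite /= gM mactM.
set M := RMod _ _ _ _.
have act_r (m : N) x : mscale m (g (h x)) = mscale m x by rewrite hK.
have act_l (m : N) x : mscale m x = mscale m (g (h x)) by rewrite hK.
constructor; refine (@Iso k (modcat A) (restr_ob M) N
  (@mkmodhom _ _ (restr_ob M) N id (fun c x y => erefl) act_r)
  (@mkmodhom _ _ N (restr_ob M) id (fun c x y => erefl) act_l) _ _).
  exact: (@modhom_eq _ _ (restr_ob M) (restr_ob M)).
exact: (@modhom_eq _ _ N N).
Qed.

End Restriction.

Lemma morita_alg_isomorphic (k : fieldType) (A B A' : kalg k) :
  alg_isomorphic A B -> morita_equivalent A A' -> morita_equivalent B A'.
Proof.
case=> h [h_bij h_lin h1 hM] [F Feq].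
exact: equivalence_comp (@restr_equivalence k A B h h_lin h1 hM h_bij) Feq.
Qed.

(** * Basic endomorphism algebras *)

Section FinDim.
Variable k : fieldType.

(** Since [fin_dim] asks for a spanning family only, the images of the spanning families of all the
    [W t] suffice, with no independence to check. *)
Lemma fin_dim_sum (V : lmodType k) (T : finType) (W : T -> lmodType k)
    (l : forall t, W t -> V) :
  (forall t c x y, l t (c *: x + y) = c *: l t x + l t y) ->
  (forall t, fin_dim (W t)) ->
  (forall v, exists w : forall t, W t, v = \sum_t l t (w t)) -> fin_dim V.
Proof.
move=> l_lin Wfin Vsum.
have fin_t t : {d & {b : 'I_d -> W t | forall w, exists c, w = \sum_i c i *: b i}}.
  by have /cid[d /cid[b bP]] := Wfin t; exists d, b.
pose d t := projT1 (fin_t t); pose b t : 'I_(d t) -> W t := sval (projT2 (fin_t t)).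
have bP t w : exists c, w = \sum_i c i *: b t i := svalP (projT2 (fin_t t)) w.
pose J : finType := {t : T & 'I_(d t)}.
have lZ t c x : l t (c *: x) = c *: l t x.
  have l0 : l t 0 = 0.
    by have := l_lin t (-1) 0 0; rewrite !scaler0 !addr0 scaleN1r addNr.
  by rewrite -[c *: x]addr0 l_lin l0 addr0.
have l_sum t (F : 'I_(d t) -> W t) : l t (\sum_i F i) = \sum_i l t (F i).
  apply: (big_morph (l t)) => [x y|]; last by rewrite -(scale0r 0) lZ scale0r.
  by rewrite -[x in LHS]scale1r l_lin scale1r.
exists #|J|, (fun i => let: existT t j := (enum_val i : J) in l t (b t j)) => v.
have [w vE] := Vsum v.
pose c t := sval (cid (bP t (w t))).
have cP t : w t = \sum_i c t i *: b t i := svalP (cid (bP t (w t))).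
exists (fun i => let: existT t j := (enum_val i : J) in c t j).
rewrite vE.
transitivity (\sum_(p : J) c (tag p) (tagged p) *: l (tag p) (b (tag p) (tagged p))).
  rewrite -(sig_big_dep xpredT (fun _ => xpredT)
      (fun t j => c t j *: l t (b t j))) /=.
  apply: eq_bigr => t _; rewrite [in LHS]cP l_sum; apply: eq_bigr => j _.
  exact: lZ.
rewrite (reindex (@enum_val J predT)) /=; last first.
  by apply: onW_bij; exact: enum_val_bij.
by apply: eq_bigr => i _; case: (enum_val i).
Qed.

Lemma fin_dim_image (V W : lmodType k) (l : W -> V) :
  (forall c x y, l (c *: x + y) = c *: l x + l y) -> fin_dim W ->
  (forall v, exists w, v = l w) -> fin_dim V.
Proof.
move=> l_lin Wfin lP; apply: (@fin_dim_sum V unit (fun=> W) (fun=> l)) => // v.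
by have [w ->] := lP v; exists (fun=> w); rewrite big_const card_unit /= addr0.
Qed.

Lemma fin_dim_ffun (V : lmodType k) (T : finType) :
  fin_dim V -> fin_dim ({ffun T -> V} : lmodType k).
Proof.
move=> Vfin; pose l (t : T) (v : V) := [ffun u => if u == t then v else 0] : {ffun T -> V}.
apply: (@fin_dim_sum _ T (fun=> V) l) => // [t c x y|f].
  by apply/ffunP=> u; rewrite !ffunE; case: eqP => _ //; rewrite scaler0 addr0.
exists f; apply/ffunP=> u; rewrite sum_ffunE (bigD1 u) //= ffunE eqxx.
by rewrite big1 ?addr0 // => t tu; rewrite ffunE eq_sym (negPf tu).
Qed.

End FinDim.

Section BasicEndalg.
Variables (k : fieldType) (C : lincat k).

Definition postcomp (P X Y : C) (f : mor X Y) : modhom (homod P X) (homod P Y) :=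
  @mkmodhom _ _ (homod P X) (homod P Y) (fun g : mor P X => f ∘ g)
    (fun c g g' => comp_linr f c g g') (fun g b => @compmA k C _ _ _ _ f g b).

(** Every [f : P -> X] equals [p ∘ (i ∘ f)], so [u] is determined by its value at [p]. With
    [postcomp_inj], the functor Hom(P, -) is fully faithful on retracts of [P]. *)
Lemma homod_full (P X Y : C) (p : mor P X) (i : mor X P) (u : modhom (homod P X) (homod P Y)) :
  p ∘ i = mid X -> u = postcomp P (mmor u p ∘ i).
Proof.
move=> pi1; apply: modhom_eq => f /=.
rewrite -[in LHS](comp1m f) -pi1 -compmA homod_comp /=.
by rewrite compmA.
Qed.

Lemma postcomp_inj (P X Y : C) (p : mor P X) (i : mor X P) (f g : mor X Y) :
  p ∘ i = mid X -> postcomp P f = postcomp P g -> f = g.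
Proof.
move=> pi1 /(congr1 (fun u : modhom (homod P X) (homod P Y) => mmor u p ∘ i)) /=.
by rewrite -!compmA pi1 !compm1.
Qed.

(** The regular module is the direct sum of the modules Hom(P, X i). As Hom(P, -) is fully faithful
    on the [X i], these modules inherit the triviality of idempotents, hence indecomposability, and
    pairwise non-isomorphism. *)
Lemma basic_endalg (I : finType) (X : I -> C) (P : C) (inj : forall i, mor (X i) P) :
  is_dsum inj -> fin_dim (mor P P) -> (forall i, ~ is_zero (X i)) ->
  (forall i (e : mor (X i) (X i)), e ∘ e = e -> e = 0 \/ e = mid (X i)) ->
  (forall i j, isomorphic (X i) (X j) -> i = j) -> basic (endalg P).
Proof.
move=> /dsum_proj[pr [pr1 pr0 prS]] Pfin Xn0 Xidem Xiso; split=> //.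
pose M (i : 'I_#|I|) : modcat (endalg P) := homod P (X (enum_val i)).
pose jj i : modhom (M i) (homod P P) := postcomp P (inj (enum_val i)).
pose qq i : modhom (homod P P) (M i) := postcomp P (pr (enum_val i)).
exists #|I|, M, jj; split=> [|i|i j [[u v vu uv]]].
- apply: (@dsum_of_proj k (modcat (endalg P)) _ M (homod P P) jj qq) => [i|i j ij|].
  + by apply: (@modhom_eq _ _ (M i) (M i)) => f; rewrite /= compmA pr1 comp1m.
  + apply: (@modhom_eq _ _ (M j) (M i)) => f; rewrite /= compmA pr0 ?comp0m //.
    by apply: contraNneq ij => /enum_val_inj ->.
  + apply: (@modhom_eq _ _ (homod P P) (homod P P)) => f.
    rewrite msum_apply /= -[RHS]comp1m -prS comp_suml.
    rewrite [RHS](reindex (@enum_val I predT)) /=; last first.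
      by apply: onW_bij; exact: enum_val_bij.
    by apply: eq_bigr => i _; rewrite compmA.
- split=> [M0|N h /dsum_proj[g [g1 g0 gS]]].
    have /(congr1 (fun u : modhom (M i) (M i) => mmor u (pr (enum_val i)))) /= := M0.
    by move=> p0; apply: (Xn0 (enum_val i)); rewrite /is_zero -pr1 p0 comp0m.
  (* The projector onto the summand [N true] comes from an idempotent [f] of [X]: if [f] is 0 then
     [N true] vanishes, and if [f] is the identity then [N false] does. *)
  pose e : mor (M i) (M i) := h true ∘ g true.
  have ee : e ∘ e = e by rewrite /e compmA (comp_cancelr _ (g1 true)).
  have eE := homod_full (e : modhom _ _) (pr1 (enum_val i)).
  set f := (_ ∘ inj _) in eE.
  have ff : f ∘ f = f.
    apply: (postcomp_inj (pr1 (enum_val i))); rewrite -[RHS]eE -ee.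
    by rewrite eE; apply: (@modhom_eq _ _ (M i) (M i)) => x; rewrite /= compmA.
  have [f0|f1] := Xidem _ f ff.
    exists true; rewrite /is_zero -[LHS]comp1m -[X in X ∘ _](g1 true).
    rewrite -[g true](comp_cancell _ (g1 true)) -/e.
    have -> : e = 0.
      by rewrite eE f0; apply: (@modhom_eq _ _ (M i) (M i)) => x; rewrite /= comp0m.
    by rewrite compm0 comp0m comp0m.
  exists false; rewrite /is_zero -[LHS]comp1m -[X in X ∘ _](g1 false).
  have -> : h false = e ∘ h false.
    have -> : e = mid (M i).
      by rewrite eE f1; apply: (@modhom_eq _ _ (M i) (M i)) => x; rewrite /= comp1m.
    by rewrite comp1m.
  by rewrite /e -(compmA (h true)) g0 // !compm0 comp0m.
- have uE := homod_full (u : modhom _ _) (pr1 (enum_val i)).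
  have vE := homod_full (v : modhom _ _) (pr1 (enum_val j)).
  apply/enum_val_inj/Xiso; constructor.
  exists (mmor (u : modhom _ _) (pr (enum_val i)) ∘ inj (enum_val i))
         (mmor (v : modhom _ _) (pr (enum_val j)) ∘ inj (enum_val j)).
    apply: (postcomp_inj (pr1 (enum_val i))); rewrite -[RHS](_ : mid (M i) = _).
      rewrite -vu [in RHS]uE [in RHS]vE.
      by apply: (@modhom_eq _ _ (M i) (M i)) => x; rewrite /= -!compmA.
    by apply: (@modhom_eq _ _ (M i) (M i)) => x; rewrite /= comp1m.
  apply: (postcomp_inj (pr1 (enum_val j))); rewrite -[RHS](_ : mid (M j) = _).
    rewrite -uv [in RHS]uE [in RHS]vE.
    by apply: (@modhom_eq _ _ (M j) (M j)) => x; rewrite /= -!compmA.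
  by apply: (@modhom_eq _ _ (M j) (M j)) => x; rewrite /= comp1m.
Qed.

End BasicEndalg.

(** * Free equivariant objects *)

Section Equivariant.
Variables (k : fieldType) (gT : finGroupType) (D : tricat k) (a : gaction gT D).
Notation G := [set: gT].

Lemma iso_epi (X Y Z : D) (e : iso X Y) (u v : mor Y Z) :
  u ∘ isohom e = v ∘ isohom e -> u = v.
Proof.
by move=> uv; rewrite -[u]compm1 -[v]compm1 -(isoVK e) !compmA uv.
Qed.

Lemma iso_monic (X Y Z : D) (e : iso Y Z) (u v : mor X Y) :
  isohom e ∘ u = isohom e ∘ v -> u = v.
Proof.
by move=> uv; rewrite -[u]comp1m -[v]comp1m -(isoK e) -!compmA uv.
Qed.

Lemma lam_mul (H : {group gT}) (X : linearised a H) g h u (e : (g * h)%g = u)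
    (gH : g \in H) (hH : h \in H) (uH : u \in H) :
  isohom (eps a e (eob X)) ∘ fmap (a g) (isohom (lam X hH)) ∘ isohom (lam X gH)
  = isohom (lam X uH).
Proof.
by case: u / e uH => uH; rewrite (bool_irrelevance uH (groupM gH hH)) lamM.
Qed.

Lemma lam_irr (H : {group gT}) (X : linearised a H) g (gH gH' : g \in H) :
  lam X gH = lam X gH'.
Proof. by rewrite (bool_irrelevance gH gH'). Qed.

Lemma lam_inv_mul (H : {group gT}) (X : linearised a H) g h u (e : (g * h)%g = u)
    (gH : g \in H) (hH : h \in H) (uH : u \in H) :
  isohom (lam X gH) ∘ isoinv (lam X uH) ∘ isohom (eps a e (eob X))
  = fmap (a g) (isoinv (lam X hH)).
Proof.
apply: (iso_epi (e := act_iso a g (lam X hH))); rewrite /= -fmapM isoK fmap1.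
apply: (iso_epi (e := lam X gH)).
by rewrite -!compmA (compmA (isohom (eps _ _ _))) lam_mul isoK comp1m compm1.
Qed.

(* The isomorphism [lam X 1] identifies [eob X] with [a 1 (eob X)]. *)
Lemma eps_lam1 (H : {group gT}) (X : linearised a H) g (e : (g * 1)%g = g)
    (H1 : 1%g \in H) :
  isohom (eps a e (eob X)) ∘ fmap (a g) (isohom (lam X H1)) = mid (a g (eob X)).
Proof.
have eps11 : isohom (eps a (mulg1 1%g) (eob X)) ∘ fmap (a 1%g) (isohom (lam X H1))
    = mid _.
  by apply: (iso_epi (e := lam X H1)); rewrite lam_mul comp1m.
apply: (iso_monic (e := act_iso a g (lam X H1))) => /=.
rewrite compm1 compmA (eps_nat a e (isohom (lam X H1))).
have := eps_assoc a e (mulg1 1%g) e e (eob X).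
move=> assoc; have {assoc} := iso_monic assoc => ->.
by rewrite -fmapM eps11 fmap1 comp1m.
Qed.

Lemma emor_sum (H : {group gT}) (X Y : linearised a H) I (r : seq I) (P : pred I)
    (f : I -> eqhom X Y) :
  emor (\sum_(i <- r | P i) f i) = \sum_(i <- r | P i) emor (f i).
Proof. exact: (big_morph (@emor _ _ _ _ _ X Y)). Qed.

(** Linearisations carry no explicit unit axiom; but conjugation by 1 is idempotent by [conjm_comp]
    and injective because [a 1] is faithful, hence it is the identity. *)
Lemma conjm1 (H : {group gT}) (X Y : linearised a H) (H1 : 1%g \in H)
    (f : mor (eob X) (eob Y)) : conjm X Y H1 f = f.
Proof.
have conj_inj : injective (conjm X Y H1).
  move=> f1 f2 e; have [/(_ (eob X) (eob Y))/bij_inj inj _] := act_equiv a 1%g.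
  apply: inj; apply: (iso_epi (e := lam X H1)).
  apply: (iso_monic (e := iso_sym (lam Y H1))).
  by rewrite /= !compmA.
by apply: conj_inj; rewrite (conjm_comp H1 H1 H1) // mulg1.
Qed.

(* [Q] is the direct sum of the translates of [Y], with the linearisation
   permuting them; it is induced from [Y] in [D^1]. *)
Definition is_free (Y : D) (Q : linearised a G) (j : forall g, mor (a g Y) (eob Q)) :=
  is_dsum j /\
  (forall g h u (e : (g * h)%g = u),
     isohom (lam Q (in_setT g)) ∘ j u ∘ isohom (eps a e Y) = fmap (a g) (j h)).

(** The linearisation [L g] carries the summand at [g * h] to the image under [a g] of the summand
    at [h], through the inverse of [eps]. Checked on summands, the linearisation condition reduces
    to [eps_assoc]. *)
Lemma free_exists (Y : D) : cocomplete D ->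
  exists (Q : linearised a G) (j : forall g, mor (a g Y) (eob Q)), is_free j.
Proof.
move=> /(_ gT (fun g => a g Y))[P [j jP]].
have [pr [pr1 pr0 prS]] := dsum_proj jP.
pose L g := \sum_h fmap (a g) (j h) ∘ isoinv (eps a (erefl (g * h)%g) Y) ∘ pr (g * h)%g.
pose L' g := \sum_h j (g * h)%g ∘ isohom (eps a (erefl (g * h)%g) Y) ∘ fmap (a g) (pr h).
have LE g h u (e : (g * h)%g = u) : L g ∘ j u ∘ isohom (eps a e Y) = fmap (a g) (j h).
  case: u / e; rewrite /L comp_suml (bigD1 h) //= -(compmA _ (pr _)) pr1 compm1.
  rewrite big1 ?addr0 => [|l lh]; last first.
    by rewrite -compmA pr0 ?compm0 // (inj_eq (mulgI g)).
  by rewrite -compmA isoK compm1.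
have L'E g h u (e : (g * h)%g = u) :
    L' g ∘ fmap (a g) (j h) = j u ∘ isohom (eps a e Y).
  case: u / e; rewrite /L' comp_suml (bigD1 h) //= -compmA -fmapM pr1 fmap1 compm1.
  by rewrite big1 ?addr0 // => l lh; rewrite -compmA -fmapM pr0 // fmap0 compm0.
have LL g : L' g ∘ L g = mid P.
  apply: (dsum_eq jP) => u; apply: (iso_epi (e := eps a (mulKVg g u) Y)).
  by rewrite -!compmA (compmA (L g)) LE (L'E _ _ _ (mulKVg g u)) comp1m.
(* Here the source is [a g P], whose identity is decomposed by applying [a g] to [prS]. *)
have LL' g : L g ∘ L' g = mid (a g P).
  rewrite -(fmap1 (a g)) -prS fmap_sum -[LHS]compm1 -(fmap1 (a g)) -prS fmap_sum comp_sumr.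
  apply: eq_bigr => h _; rewrite fmapM compmA; congr (_ ∘ _).
  by rewrite -compmA (L'E _ _ _ erefl) compmA LE.
pose lamQ g (gG : g \in G) := Iso (LL g) (LL' g).
have lamQM g h (gG : g \in G) (hG : h \in G) :
    isohom (eps a (erefl (g * h)%g) P) ∘ fmap (a g) (isohom (lamQ h hG)) ∘ isohom (lamQ g gG)
    = isohom (lamQ (g * h)%g (groupM gG hG)).
  apply: (dsum_eq jP) => u /=; pose l := ((g * h)^-1 * u)%g.
  have e3 : (g * h * l)%g = u by rewrite mulKVg.
  have e4 : (g * (h * l))%g = u by rewrite mulgA.
  apply: (iso_epi (e := eps a e3 Y)).
  apply: (iso_epi (e := eps a (erefl (g * h)%g) (a l Y))).
  rewrite LE -(compmA _ (isohom (eps a e3 Y))).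
  rewrite (eps_assoc a (erefl _) (erefl (h * l)%g) e3 e4) compmA.
  rewrite -(compmA _ (L g)) -(compmA _ (L g ∘ _)) LE -!compmA -!fmapM.
  by rewrite (compmA (L h)) LE (eps_nat a (erefl (g * h)%g)).
by exists (Linearised lamQM), j.
Qed.

Section Free.
Variables (Y : D) (Q : linearised a G) (j : forall g, mor (a g Y) (eob Q)).
Hypothesis Qfree : is_free j.

Lemma free_lam g h u (e : (g * h)%g = u) :
  isohom (lam Q (in_setT g)) ∘ j u ∘ isohom (eps a e Y) = fmap (a g) (j h).
Proof. by case: Qfree. Qed.

Lemma free_laminv g h u (e : (g * h)%g = u) :
  isoinv (lam Q (in_setT g)) ∘ fmap (a g) (j h) = j u ∘ isohom (eps a e Y).
Proof. by rewrite -(free_lam e) -compmA (comp_cancell _ (isoK _)). Qed.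

Lemma free_eq (Z : eqcat a G) (f f' : @mor k (eqcat a G) Q Z) :
  (forall g, emor f ∘ j g = emor f' ∘ j g) -> f = f'.
Proof. by case: Qfree => Qsum _ ff'; apply/val_inj/(dsum_eq Qsum). Qed.

Lemma free_mor (Z : linearised a G) (f : mor (eob Q) (eob Z)) :
  (forall g h u (e : (g * h)%g = u),
     isohom (lam Z (in_setT g)) ∘ f ∘ j u ∘ isohom (eps a e Y) = fmap (a g) (f ∘ j h)) ->
  f \in @invariantb _ _ _ a _ Q Z.
Proof.
case: Qfree => Qsum Qlam fE; apply: invariantbP => g gG.
rewrite (bool_irrelevance gG (in_setT g)).
apply: (dsum_eq Qsum) => u; apply: (iso_epi (e := eps a (mulKVg g u) Y)).
by rewrite fE fmapM -!compmA (compmA (isohom (lam Q _))) Qlam.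
Qed.

(** Existence half of the universal property of free objects: equivariance dictates the value on
    each translate, and [lam_inv_mul] makes these values compatible. *)
Lemma free_ext (Z : eqcat a G) (p : mor Y (eob Z)) :
  exists f : @mor k (eqcat a G) Q Z,
    forall g, emor f ∘ j g = isoinv (lam Z (in_setT g)) ∘ fmap (a g) p.
Proof.
case: (Qfree) => Qsum _.
have [f [fE _]] := Qsum _ (fun g => isoinv (lam Z (in_setT g)) ∘ fmap (a g) p).
have fI : f \in @invariantb _ _ _ a _ Q Z.
  apply: free_mor => g h u e; rewrite -(compmA _ f) !fE fmapM.
  rewrite -(lam_inv_mul Z e (in_setT g) (in_setT h) (in_setT u)) -!compmA.
  by rewrite -(eps_nat a e).
by exists (EqHom fI).
Qed.

End Free.

(* The functoriality of free objects, extended to morphisms between [Y'] and a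
   translate of [Y]. *)
Lemma free_through (Y : D) (Q : eqcat a G) (j : forall g, mor (a g Y) (eob Q))
    (Y' : D) (Q' : eqcat a G) (j' : forall g, mor (a g Y') (eob Q'))
    g (p : mor Y' (a g Y)) (q : mor (a g Y) Y') : is_free j -> is_free j' ->
  exists f : mor Q' Q', @through k (eqcat a G) Q _ _ f /\
    forall h, emor f ∘ j' h = j' h ∘ fmap (a h) (q ∘ p).
Proof.
move=> Qfree Q'free; case: (Qfree) => Qsum _; case: (Q'free) => _ Q'lam.
(* The summand of [Q] at [u = h * g] is a_h a_g Y up to [eps], and a_h q takes it to the summand of
   [Q'] at [h]; hence the index [u * g^-1]. *)
have [q' [q'E _]] := Qsum _ (fun u => j' (u * g^-1)%g ∘ fmap (a (u * g^-1)%g) q ∘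
  isoinv (eps a (mulgKV g u) Y)).
have {}q'E h u (e : (h * g)%g = u) : q' ∘ j u ∘ isohom (eps a e Y) = j' h ∘ fmap (a h) q.
  have eh : h = (u * g^-1)%g by rewrite -e mulgK.
  subst h; rewrite (eq_irrelevance e (mulgKV g u)) q'E.
  by rewrite -compmA isoK compm1.
have q'I : q' \in @invariantb _ _ _ a _ Q Q'.
  apply: (free_mor Qfree) => h w u e; pose l := (w * g^-1)%g.
  have e2 : (l * g)%g = w by rewrite mulgKV.
  have e4 : (h * l * g)%g = u by rewrite -mulgA e2.
  apply: (iso_epi (e := act_iso a h (eps a e2 Y))) => /=.
  rewrite -compmA -(eps_assoc a (erefl (h * l)%g) e2 e4 e) -fmapM q'E.
  rewrite compmA -!(compmA (isohom (lam _ _))) q'E.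
  by rewrite -!compmA (eps_nat a (erefl (h * l)%g) q) 2!compmA Q'lam fmapM.
have [p' p'E] := free_ext Q'free (j g ∘ p).
exists (@mcomp k (eqcat a G) Q' Q Q' (EqHom q'I) p'); split=> [|h].
  exact: through_comp.
rewrite /= -compmA p'E fmapM (compmA (isoinv _)) (free_laminv Qfree (erefl (h * g)%g)).
by rewrite !compmA q'E -compmA -fmapM.
Qed.

(** By [free_through], a decomposition of the identity of [Y'] through translates of the [Y t]
    induces one of the identity of [Q'] through the [Q t], and these in turn go through [Z]. *)
Lemma free_through_mid (Y' : D) (Q' : eqcat a G) (j' : forall g, mor (a g Y') (eob Q'))
    (Z : eqcat a G) (T : finType) (Y : T -> D) (Q : T -> eqcat a G)
    (j : forall t g, mor (a g (Y t)) (eob (Q t))) (g : T -> gT)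
    (p : forall t, mor Y' (a (g t) (Y t))) (q : forall t, mor (a (g t) (Y t)) Y') :
  is_free j' -> (forall t, is_free (j t)) ->
  (forall t, @through k (eqcat a G) Z _ _ (@mid k (eqcat a G) (Q t))) ->
  \sum_t q t ∘ p t = mid Y' ->
  @through k (eqcat a G) Z _ _ (@mid k (eqcat a G) Q').
Proof.
move=> Q'free Qfree QZ qpS.
have fP t := cid (free_through (p t) (q t) (Qfree t) Q'free).
pose f t := sval (fP t).
have -> : @mid k (eqcat a G) Q' = \sum_t f t.
  apply: (free_eq Q'free) => h.
  rewrite emor_sum comp_suml; under eq_bigr do rewrite (svalP (fP _)).2.
  by rewrite -comp_sumr -fmap_sum qpS fmap1 compm1 comp1m.
apply: through_sum => t _; apply: through_trans (QZ t) _.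
exact: (svalP (fP t)).1.
Qed.

(** * The skew group algebra as an endomorphism algebra *)

Section SkewAlgebra.
Variables (X : linearised a G) (Q : eqcat a G) (j : forall g, mor (a g (eob X)) (eob Q)).
Hypothesis Qfree : is_free j.

(* [Q] is the tensor product of the regular representation with [X], the
   [inj g] being the inclusions along its basis. *)
Lemma free_regular :
  exists (inj : gT -> mor (eob X) (eob Q)) (pr : gT -> mor (eob Q) (eob X)),
  [/\ forall g h, pr g ∘ inj h = if g == h then mid (eob X) else 0,
      \sum_g inj g ∘ pr g = mid (eob Q),
      forall h (hG : h \in G) g,
        fmap (a h) (inj (g * h)%g) ∘ isohom (lam X hG) = isohom (lam Q hG) ∘ inj g
    & forall g, inj g = j g^-1%g ∘ isohom (lam X (in_setT g^-1%g))].
Proof.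
case: (Qfree) => Qsum Qlam; have [pr [pr1 pr0 prS]] := dsum_proj Qsum.
pose lamX g := lam X (in_setT g^-1%g).
exists (fun g => j g^-1%g ∘ isohom (lamX g)), (fun g => isoinv (lamX g) ∘ pr g^-1%g).
split=> [g h||h hG g|] //.
- rewrite -compmA (compmA (pr _)); case: eqP => [->|/eqP gh].
    by rewrite pr1 comp1m isoK.
  by rewrite pr0 ?(inj_eq invg_inj) // comp0m compm0.
- rewrite -prS [RHS](reindex_inj invg_inj); apply: eq_bigr => g _ /=.
  by rewrite -compmA (comp_cancell _ (isoVK _)).
- have e : (h * (g * h)^-1)%g = g^-1%g by rewrite invMg mulKVg.
  rewrite fmapM -(Qlam _ _ _ e) -!compmA (compmA (isohom (eps _ _ _))).
  by rewrite (lam_mul X e hG _ (in_setT _)) (lam_irr Q hG (in_setT h)).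
Qed.

(** An endomorphism of [Q] is a matrix over End(X) indexed by the group. Equivariance ([entry_conj])
    expresses the entry at (u, h) as the entry at (u h^-1, 1) acted on by h, so the column at 1
    determines the matrix, and the matrix product becomes the skew product. *)
Lemma skew_alg_isomorphic :
  alg_isomorphic (@endalg k (eqcat a G) Q) (skew_alg (end_action X)).
Proof.
have [inj [pr [prE prS injE inj_j]]] := free_regular.
have inj_epi (W : D) (u v : mor (eob Q) W) : (forall g, u ∘ inj g = v ∘ inj g) -> u = v.
  move=> uv; rewrite -[u]compm1 -[v]compm1 -prS !comp_sumr.
  by apply: eq_bigr => g _; rewrite !compmA uv.
have prEl h (hG : h \in G) g :
    isoinv (lam X hG) ∘ fmap (a h) (pr (g * h)%g) = pr g ∘ isoinv (lam Q hG).
  apply: (iso_epi (e := lam Q hG)); apply: inj_epi => u.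
  rewrite -!compmA (compmA (isoinv (lam Q _))) isoK comp1m -injE prE.
  rewrite (compmA (fmap _ _)) -fmapM prE (inj_eq (mulIg h)).
  by case: eqP => _; rewrite ?fmap1 ?comp1m ?isoK // fmap0 comp0m compm0.
pose entry (f : @mor k (eqcat a G) Q Q) g h : endalg (eob X) := pr g ∘ emor f ∘ inj h.
have entry_conj f u h :
    end_ract (X := X) (entry f (u * h^-1)%g 1%g) h = entry f u h.
  rewrite /end_ract /conjm /entry !fmapM !compmA prEl -!compmA.
  have := injE h^-1%g (in_setT _) h; rewrite mulgV => ->.
  by rewrite (compmA (fmap _ _)) emorE -!compmA (compmA (isoinv (lam Q _))) isoK comp1m.
pose Phi (f : @mor k (eqcat a G) Q Q) : {ffun gT -> endalg (eob X)} :=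
  [ffun g => entry f g 1%g].
have entry_col f h : emor f ∘ inj h = \sum_g inj g ∘ entry f g h.
  rewrite -[LHS]comp1m -prS comp_suml; apply: eq_bigr => g _.
  by rewrite /entry !compmA.
exists Phi; split.
- apply: inj_surj_bij => [f f' ff'|x].
    apply/val_inj/inj_epi => h; rewrite /= !entry_col; apply: eq_bigr => g _.
    rewrite -(entry_conj f) -(entry_conj f'); congr (_ ∘ end_ract _ _).
    by have /ffunP/(_ (g * h^-1)%g) := ff'; rewrite !ffunE.
  (* The endomorphism whose column at 1 is [x]. *)
  have [f fE] := free_ext Qfree (\sum_g inj g ∘ x g).
  exists f; apply/ffunP => g; rewrite ffunE /entry -compmA.
  have -> : emor f ∘ inj 1%g = \sum_g inj g ∘ x g.
    rewrite inj_j compmA fE; case: _ / (esym (@invg1 gT)).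
    exact: conjm1.
  rewrite comp_sumr (bigD1 g) //= compmA prE eqxx comp1m.
  rewrite big1 ?addr0 // => h hg; rewrite compmA prE eq_sym (negPf hg).
  exact: comp0m.
- move=> c f f'; apply/ffunP => g; rewrite !ffunE /entry.
  by rewrite /= comp_linr comp_linl.
- apply/ffunP => g; rewrite !ffunE /entry /= compm1.
  by rewrite prE.
- move=> f f'; apply/ffunP => u; rewrite !ffunE /entry /= -compmA -compmA entry_col.
  rewrite !comp_sumr; apply: eq_bigr => h _.
  by rewrite !ffunE entry_conj /entry /= !compmA.
Qed.

End SkewAlgebra.

(** * Induction *)

Section Induction.
Variable H : {group gT}.

(** That is, [eta] is a universal arrow from [Y] to the restriction functor, expressed through
    underlying morphisms in [D]. *)
Record is_induced (Y : eqcat a H) (IY : eqcat a G) (eta : mor (eob Y) (eob IY)) : Prop :=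
  IsInduced {
    induced_eq : forall g (gH : g \in H),
      fmap (a g) eta ∘ isohom (lam Y gH) = isohom (lam IY (in_setT g)) ∘ eta;
    induced_ext : forall (Z : eqcat a G) (f : mor (eob Y) (eob Z)),
      (forall g (gH : g \in H),
         fmap (a g) f ∘ isohom (lam Y gH) = isohom (lam Z (in_setT g)) ∘ f) ->
      exists u : mor IY Z, emor u ∘ eta = f;
    induced_inj : forall (Z : eqcat a G) (u v : mor IY Z),
      emor u ∘ eta = emor v ∘ eta -> u = v }.

Lemma ind_unit (I : induction_functor a H) :
  exists eta : forall Y : eqcat a H, mor (eob Y) (eob (I Y)),
    (forall Y, is_induced (eta Y)) /\ (forall (Y Y' : eqcat a H) (v : mor Y Y'),
       emor (fmap I v) ∘ eta Y = eta Y' ∘ emor v).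
Proof.
have [alpha [alpha_bij alpha_nat]] := ind_left I.
pose eta Y := alpha Y (I Y) (mid (I Y)).
have lamR (Z : eqcat a G) g (gH : g \in H) :
    lam (res a (subsetT H) Z) gH = lam Z (in_setT g) by exact: (lam_irr Z).
have alphaE Y Z (u : mor (I Y) Z) : alpha Y Z u = fmap (res a (subsetT H)) u ∘ eta Y.
  have := alpha_nat _ _ _ _ (mid Y) (mid (I Y)) u.
  by rewrite fmap1 !compm1.
exists (fun Y => emor (eta Y)); split=> [Y|Y Y' v]; first split.
- by move=> g gH; have := emorE (eta Y) gH; rewrite lamR.
- move=> Z f fE.
  have fI : f \in @invariantb _ _ _ a _ Y (res a (subsetT H) Z).
    by apply: invariantbP => g gH; rewrite fE lamR.
  have [beta betaK alphaK] := alpha_bij Y Z; exists (beta (EqHom fI)).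
  by have /(congr1 (fun w => emor w)) := alphaK (EqHom fI); rewrite alphaE.
- move=> Z u v uv; apply: (bij_inj (alpha_bij Y Z)); rewrite !alphaE.
  exact: val_inj.
have := alpha_nat _ _ _ _ v (mid (I Y')) (mid (I Y')); rewrite fmap1 !comp1m.
move=> E; transitivity (emor (alpha Y (I Y') (fmap I v))); last by rewrite E.
by rewrite alphaE.
Qed.

Hypothesis H_unit : #|H|%:R != 0 :> k.
Variables (Y : eqcat a H) (IY : eqcat a G) (eta : mor (eob Y) (eob IY)).
Hypothesis etaP : is_induced eta.

(* [IY] is a retract of the free object on the object underlying [Y]: the
   composite of the maps corresponding to [\sum_h j h ∘ lam h] and to the unit
   is the average over [H] of the conjugates of the unit. *)
Lemma induced_retract (Q : eqcat a G) (j : forall g, mor (a g (eob Y)) (eob Q)) :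
  is_free j ->
  exists (theta : mor IY Q) (zeta : mor Q IY),
    [/\ zeta ∘ theta = mid IY,
        emor theta ∘ eta = \sum_(h : subg_of H) j (sgval h) ∘ isohom (lam Y (subgP h))
      & forall h (hH : h \in H),
          emor zeta ∘ j h ∘ isohom (lam Y hH) = (#|H|%:R)^-1 *: eta].
Proof.
case: etaP => eta_eq eta_ext eta_inj Qfree.
have [theta thetaE] : exists u : mor IY Q,
    emor u ∘ eta = \sum_(h : subg_of H) j (sgval h) ∘ isohom (lam Y (subgP h)).
  apply: eta_ext => g gH; rewrite fmap_sum comp_suml comp_sumr.
  rewrite [RHS](reindex_inj (mulgI (subg H g))) /=; apply: eq_bigr => h _.
  have e : (g * sgval h)%g = sgval (subg H g * h)%g by rewrite /= subgK.
  rewrite fmapM -(free_lam Qfree e) -!compmA (compmA (isohom (eps _ _ _))).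
  by rewrite (lam_mul Y e gH _ (subgP _)).
have [zeta zetaE] := free_ext Qfree ((#|H|%:R)^-1 *: eta).
have zetaH h (hH : h \in H) :
    emor zeta ∘ j h ∘ isohom (lam Y hH) = (#|H|%:R)^-1 *: eta.
  rewrite zetaE fmapZ compZr compZl -compmA eta_eq.
  by rewrite (comp_cancell _ (isoK _)).
exists theta, zeta; split=> //; apply: eta_inj.
rewrite /= -compmA thetaE comp1m comp_sumr.
under eq_bigr do rewrite compmA zetaH.
by rewrite sumr_const -scaler_nat scalerA card_sub mulfV ?scale1r.
Qed.

(** If [IY] is zero then so is [theta]; but the component of [theta ∘ eta] at the summand 1 is the
    isomorphism [lam Y 1]. *)
Lemma induced_neq0 : cocomplete D -> ~ is_zero (eob Y) -> ~ is_zero IY.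
Proof.
move=> Dcoc Yn0 IY0; have [Q [j Qfree]] := free_exists (eob Y) Dcoc.
have [theta [zeta [_ thetaE _]]] := induced_retract Qfree.
have [pr [pr1 pr0 _]] := dsum_proj (proj1 Qfree).
apply: Yn0; rewrite /is_zero -(isoK (lam Y (subgP 1%g))).
rewrite -[isohom _](comp_cancell _ (pr1 (sgval (1%g : subg_of H)))).
have <- : pr 1%g ∘ (emor theta ∘ eta) =
    pr 1%g ∘ (j (sgval (1%g : subg_of H)) ∘ isohom (lam Y (subgP 1%g))).
  rewrite thetaE comp_sumr (bigD1 1%g) //= [X in _ + X]big1 ?addr0 // => h h1.
  rewrite compmA pr0 ?comp0m //; apply: contraNneq h1 => h1.
  by apply/eqP/val_inj.
have -> : theta = 0 by rewrite -[theta]compm1 IY0 compm0.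
by rewrite comp0m !compm0.
Qed.

(** A substitute for the decomposition of the induced object over G/H: summing over all of G, as
    [induced_retract] permits, avoids choosing coset representatives. *)
Lemma induced_decomposition : cocomplete D ->
  exists (s : forall g, mor (a g (eob Y)) (eob IY)) (r : forall g, mor (eob IY) (a g (eob Y))),
    \sum_g s g ∘ r g = mid (eob IY) /\
    (forall h, h \in H -> exists v : mor (a h (eob Y)) (eob Y), s h = eta ∘ v).
Proof.
move=> D_cocomplete; have [Q [j Qfree]] := free_exists (eob Y) D_cocomplete.
have [theta [zeta [zt _ zetaH]]] := induced_retract Qfree.
have [pr [_ _ prS]] := dsum_proj (proj1 Qfree).
exists (fun g => emor zeta ∘ j g), (fun g => pr g ∘ emor theta); split=> [|h hH].
  have := congr1 (fun w => emor w) zt => /= <-.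
  rewrite -[emor theta in RHS]comp1m -prS comp_suml comp_sumr.
  by apply: eq_bigr => g _; rewrite !compmA.
exists ((#|H|%:R)^-1 *: isoinv (lam Y hH)); apply: (iso_epi (e := lam Y hH)).
by rewrite zetaH compZr compZl (comp_cancelr _ (isoK _)).
Qed.

(** The components of [f] at translates outside [H] vanish, so [f] factors through [eta] in [D].
    Averaging the factor over [H] makes it equivariant and keeps the composite, since [f] and [eta]
    are equivariant. *)
Lemma induced_lift (X : eqcat a H) (f : mor (eob X) (eob IY)) : cocomplete D ->
  (forall g, g \notin H -> forall u : mor (eob X) (a g (eob Y)), u = 0) ->
  (forall g (gH : g \in H),
     fmap (a g) f ∘ isohom (lam X gH) = isohom (lam IY (in_setT g)) ∘ f) ->
  exists w : mor X Y, f = eta ∘ emor w.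
Proof.
move=> D_cocomplete hom0 f_eq.
have [s [r [srS sE]]] := induced_decomposition D_cocomplete.
have [w wE] : exists w : mor (eob X) (eob Y), f = eta ∘ w.
  rewrite -[f]comp1m -srS comp_suml.
  apply: (big_ind (fun f => exists w, f = eta ∘ w)) => [|_ _ [v ->] [w ->]|g _].
  - by exists 0; rewrite compm0.
  - by exists (v + w); rewrite compDr.
  have [gH|gH] := boolP (g \in H); last first.
    have e0 : r g ∘ f = 0 by apply: hom0.
    by exists 0; rewrite -compmA e0 !compm0.
  by have [v ->] := sE g gH; exists (v ∘ r g ∘ f); rewrite !compmA.
pose w' := (#|H|%:R)^-1 *: \sum_(h : subg_of H) conjm X Y (subgP h) w.
have w'I : w' \in @invariantb _ _ _ a _ X Y.
  apply/asboolP => g gH; rewrite /conjm fmapZ compZr compZl; congr (_ *: _).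
  rewrite fmap_sum comp_sumr comp_suml.
  rewrite [RHS](reindex_inj (mulgI (subg H g))) /=; apply: eq_bigr => h _.
  by apply: (@conjm_comp _ _ _ _ _ X Y) => /=; rewrite subgK.
exists (EqHom w'I); rewrite /= compZr comp_sumr.
under eq_bigr => h _.
  rewrite /conjm !compmA.
  have -> : eta ∘ isoinv (lam Y (subgP h)) =
      isoinv (lam IY (in_setT (sgval h))) ∘ fmap (a (sgval h)) eta.
    apply: (iso_epi (e := lam Y (subgP h))).
    rewrite -compmA isoK compm1 -compmA (induced_eq etaP).
    by rewrite (comp_cancell _ (isoK _)).
  rewrite -(compmA _ (fmap _ eta)) -fmapM -wE -compmA f_eq (comp_cancell _ (isoK _)).
  over.
by rewrite sumr_const -scaler_nat scalerA card_sub mulVf ?scale1r.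
Qed.

Lemma induced_vanish (X : D) (f : mor X (eob IY)) : cocomplete D ->
  (forall g (u : mor X (a g (eob Y))), u = 0) -> f = 0.
Proof.
move=> D_cocomplete hom0; have [s [r [srS _]]] := induced_decomposition D_cocomplete.
rewrite -[f]comp1m -srS comp_suml big1 // => g _.
have e0 : r g ∘ f = 0 by apply: hom0.
by rewrite -compmA e0 compm0.
Qed.

End Induction.

Lemma induction_full (H : {group gT}) (I : induction_functor a H) (X Y : eqcat a H)
    (f : mor (I X) (I Y)) :
  #|H|%:R != 0 :> k -> cocomplete D ->
  (forall g, g \notin H -> forall u : mor (eob X) (a g (eob Y)), u = 0) ->
  exists v, f = fmap I v.
Proof.
move=> H_unit D_cocomplete hom0; have [eta [etaP eta_nat]] := ind_unit I.
have [g gH|v vE] := induced_lift H_unit (etaP Y) (f := emor f ∘ eta X) D_cocomplete hom0.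
  rewrite fmapM -compmA (induced_eq (etaP X)) !compmA.
  by rewrite emorE.
by exists v; apply: (induced_inj (etaP X)); rewrite eta_nat.
Qed.

End Equivariant.

(** * Representations *)

Section Representations.
Variables (k : fieldType) (gT : finGroupType) (H : {group gT}).

(** Schur's lemma: with representations on row vectors, the row space of [M] is a submodule for [r2]
    and its left kernel one for [r1]. *)
Lemma intertwiner_inverse d1 d2 (r1 : mx_representation k H d1)
    (r2 : mx_representation k H d2) (M : 'M_(d1, d2)) :
  mx_irreducible r1 -> mx_irreducible r2 ->
  (forall h, h \in H -> r1 h *m M = M *m r2 h) -> M != 0 ->
  mx_rsim r1 r2 /\ exists N : 'M_(d2, d1),
    [/\ M *m N = 1%:M, N *m M = 1%:M & forall h, h \in H -> r2 h *m N = N *m r1 h].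
Proof.
move=> /mx_irrP[_ irr1] /mx_irrP[_ irr2] homM nzM.
have fullM : row_full M.
  rewrite -sub1mx -(genmxE M) sub1mx; apply: irr2; last first.
    by rewrite -mxrank_eq0 mxrank_gen mxrank_eq0.
  apply/mxmoduleP=> h hH; rewrite (eqmxMr _ (genmxE M)) genmxE -homM //.
  exact: submxMl.
have freeM : row_free M.
  rewrite -kermx_eq0; apply: contraR nzM => nzK.
  have fullK : row_full (kermx M).
    apply: irr1 nzK; apply/mxmoduleP=> h hH.
    by apply/sub_kermxP; rewrite -mulmxA homM // mulmxA mulmx_ker mul0mx.
  by rewrite -[M]mul1mx; apply/eqP/sub_kermxP; rewrite sub1mx.
have [N MN NM] : exists2 N, M *m N = 1%:M & N *m M = 1%:M.
  by exists (pinvmx M); [apply: mulmxVp | apply: mulVpmx].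
split; last first.
  exists N; split=> // h hH.
  by rewrite -[LHS]mul1mx -NM -mulmxA (mulmxA M) -homM // -(mulmxA _ M) MN mulmx1.
exists M => //; apply/eqP; move: fullM freeM; rewrite /row_full /row_free => /eqP-> /eqP->.
exact: eqxx.
Qed.

Variables (I : finType) (deg : I -> nat) (rho : forall i, mx_representation k H (deg i)).
Hypotheses (H_unit : #|H|%:R != 0 :> k) (rho_irr : irr_representatives rho).

Let coefficient (f : gT -> k) := exists t : forall i, 'M[k]_(deg i),
  forall h, h \in H -> f h = \sum_i \sum_b \sum_c t i b c * rho i h b c.

Let coefficient_sum T (r : seq T) (F : T -> gT -> k) :
  (forall s, coefficient (F s)) -> coefficient (fun h => \sum_(s <- r) F s h).
Proof.
move=> Fc; elim: r => [|s r [t tE]].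
  exists (fun i => 0) => h _; rewrite big_nil big1 // => i _.
  by rewrite big1 // => b _; rewrite big1 // => c _; rewrite mxE mul0r.
have [u uE] := Fc s; exists (fun i => u i + t i) => h hH.
rewrite big_cons uE // tE // -big_split; apply: eq_bigr => i _ /=.
rewrite -big_split; apply: eq_bigr => b _ /=.
by rewrite -big_split; apply: eq_bigr => c _ /=; rewrite mxE mulrDl.
Qed.

(** A similarity with [rho i] turns the function into [u *m rho i h *m v], whose coefficient matrix
    is [(v *m u)^T] at [i] and 0 elsewhere. *)
Let coefficient_irr d (r : mx_representation k H d) (x : 'rV_d) (y : 'cV_d) :
  mx_irreducible r -> coefficient (fun h => (x *m r h *m y) 0 0).
Proof.
case: rho_irr => _ _ rho_all /rho_all[i /mx_rsim_def[B [B' _ rE]]].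
have [u uE] : exists u, u = x *m B by exists (x *m B).
have [v vE] : exists v, v = B' *m y by exists (B' *m y).
have tP : exists t : forall i', 'M[k]_(deg i'),
    t i = (v *m u)^T /\ forall i', i' != i -> t i' = 0.
  exists (fun i' => if i =P i' is ReflectT e then ecast z 'M[k]_(deg z) e (v *m u)^T else 0).
  split=> [|i' ii']; first by case: eqP => // e; rewrite eq_axiomK.
  by case: eqP => // e; rewrite e eqxx in ii'.
have [t [ti t0]] := tP; exists t => h hH.
rewrite (bigD1 i) //= [X in _ = _ + X]big1 ?addr0 => [|i' /t0 ->]; last first.
  by rewrite big1 // => b _; rewrite big1 // => c _; rewrite mxE mul0r.
rewrite rE // ti !mulmxA -uE -mulmxA -vE mxE exchange_big.
apply: eq_bigr => c _; rewrite mxE mulr_suml; apply: eq_bigr => b _.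
by rewrite !mxE big_ord1 mulrC mulrA.
Qed.

Let coefficient_any d (r : mx_representation k H d) (x : 'rV_d) (y : 'cV_d) :
  coefficient (fun h => (x *m r h *m y) 0 0).
Proof.
have redr := mx_Maschke_pchar r; rewrite /pgroup pcharf'_nat in redr.
(* Maschke's theorem gives a decomposition into simple submodules only under [classically], so the
   goal is made boolean. The vector [x] is then split along the decomposition. *)
apply/asboolP; apply: (mx_reducible_semisimple (mxmodule1 r) (redr H_unit)).
case=> T U W simU defW _; apply/asboolP.
have /sub_sumsmxP[u xE] : (x <= \sum_i U i)%MS by rewrite defW submx1.
have -> : (fun h => (x *m r h *m y) 0 0) =
    (fun h => \sum_(i <- enum T) (u i *m U i *m r h *m y) 0 0).
  apply/funext => h; rewrite big_enum {1}xE !mulmx_suml summxE.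
  by apply: eq_bigl => i.
apply: coefficient_sum => i; have [modU _ _] := simU i.
have [t tE] := coefficient_irr (in_submod (U i) (u i *m U i))
  (val_submod (1%:M : 'M_(\rank (U i))) *m y) (proj2 (submod_mx_irr modU) (simU i)).
exists t => h hH; rewrite -tE //.
rewrite mulmxA -val_submodE val_submodJ // in_submodK //.
exact: submxMl.
Qed.

(** In the regular representation, the diagonal matrix coefficient at the basis vector 1 is the
    function supported at 1. *)
Lemma irr_coefficients_delta : exists t : forall i, 'M[k]_(deg i),
  forall h, h \in H ->
    \sum_i \sum_b \sum_c t i b c * rho i h b c = (h == 1%g)%:R.
Proof.
have [t tE] := coefficient_any (regular_repr k H)
  (delta_mx 0 (gring_index H 1%g)) (delta_mx (gring_index H 1%g) 0).
exists t => h hH; rewrite -tE // -rowE rowK -[X in enum_val X]/(gring_index H 1%g).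
rewrite gring_indexK // mul1g mul_delta_mx_cond.
rewrite (can_in_eq (gring_indexK (G := H))) // eq_sym.
by case: eqP => _; rewrite ?mulr0n ?mulr1n mxE ?eqxx.
Qed.

End Representations.

(** * Tensor products with representations *)

Section RepTensor.
Variables (k : fieldType) (gT : finGroupType) (D : tricat k) (a : gaction gT D).
Variables (H : {group gT}).
Notation G := [set: gT].

Section Translate.
Variables (Y : eqcat a H) (Q : eqcat a G) (j : forall g, mor (a g (eob Y)) (eob Q)).
Hypothesis Qfree : is_free j.

(** The endomorphism of [Q] weighted by the matrix coefficient (b, c) is the extension [p] of the
    inclusion of the b-th copy of [Y], followed by a map [q] that weights the copy b' by the
    coefficient (b', c). Multiplicativity of [rho] makes [kap], and thus [q], equivariant. *)
Lemma rep_tensor_through d (rho : mx_representation k H d) (T : eqcat a H)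
    (IT : eqcat a G) (eta : mor (eob T) (eob IT)) b c :
  is_rep_tensor rho Y T -> is_induced eta ->
  exists f : mor Q Q, @through k (eqcat a G) IT _ _ f /\
    forall g, emor f ∘ j g = isoinv (lam Q (in_setT g)) ∘ fmap (a g)
      (\sum_(h : subg_of H) rho (sgval h) b c *: (j (sgval h) ∘ isohom (lam Y (subgP h)))).
Proof.
move=> [inj [injT lamT]] [_ eta_ext _].
have [kap [kapE _]] := injT _ (fun b' =>
  \sum_(h : subg_of H) rho (sgval h) b' c *: (j (sgval h) ∘ isohom (lam Y (subgP h)))).
have [q qE] : exists q : mor IT Q, emor q ∘ eta = kap.
  apply: eta_ext => g gH; apply: (dsum_eq injT) => b'.
  rewrite -compmA lamT comp_sumr -compmA kapE comp_sumr.
  rewrite [RHS](reindex_inj (mulgI (subg H g))) /=.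
  under eq_bigr => d' _.
    rewrite compZr compmA -fmapM kapE fmap_sum comp_suml scaler_sumr; over.
  rewrite exchange_big; apply: eq_bigr => h _ /=.
  have e : (g * sgval h)%g = sgval (subg H g * h)%g by rewrite /= subgK.
  have -> : rho (sgval (subg H g * h)%g) b' c = (rho g *m rho (sgval h)) b' c.
    by rewrite -e repr_mxM ?subgP.
  rewrite mxE compZr scaler_suml; apply: eq_bigr => d' _.
  rewrite fmapZ compZl scalerA; congr (_ *: _).
  rewrite fmapM -(free_lam Qfree e) -!compmA (compmA (isohom (eps _ _ _))).
  by rewrite (lam_mul Y e gH _ (subgP _)).
have [p pE] := free_ext Qfree (Z := IT) (eta ∘ inj b).
exists (q ∘ p); split=> [|g]; first exact: through_comp.
rewrite -kapE -qE /= -compmA pE -compmA [in RHS]fmapM compmA.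
have qlam : emor q ∘ isoinv (lam IT (in_setT g)) =
    isoinv (lam Q (in_setT g)) ∘ fmap (a g) (emor q).
  apply: (iso_epi (e := lam IT (in_setT g))); rewrite -!compmA isoK compm1 emorE.
  by rewrite (comp_cancell _ (isoK _)).
by rewrite qlam compmA.
Qed.

(** Combining the endomorphisms of [rep_tensor_through] with the scalars of [irr_coefficients_delta]
    leaves only the term [h = 1], which gives the identity of [Q]. *)
Lemma free_through_irr (I : finType) (deg : I -> nat)
    (rho : forall i, mx_representation k H (deg i)) (T : I -> eqcat a H)
    (IT : I -> eqcat a G) (eta : forall i, mor (eob (T i)) (eob (IT i)))
    (Z : eqcat a G) :
  #|H|%:R != 0 :> k -> irr_representatives rho ->
  (forall i, is_rep_tensor (rho i) Y (T i)) -> (forall i, is_induced (eta i)) ->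
  (forall i, @through k (eqcat a G) Z _ _ (@mid k (eqcat a G) (IT i))) ->
  @through k (eqcat a G) Z _ _ (@mid k (eqcat a G) Q).
Proof.
move=> H_unit rho_irr tensT indT ITZ.
have [t tE] := irr_coefficients_delta H_unit rho_irr.
have fP i b c := cid (rep_tensor_through b c (tensT i) (indT i)).
pose f i b c := sval (fP i b c).
have -> : @mid k (eqcat a G) Q = \sum_i \sum_b \sum_c t i b c *: f i b c.
  apply: (free_eq Qfree) => g; rewrite comp1m emor_sum.
  transitivity (isoinv (lam Q (in_setT g)) ∘ fmap (a g) (\sum_(h : subg_of H)
    (sgval h == 1%g)%:R *: (j (sgval h) ∘ isohom (lam Y (subgP h))))).
    rewrite (bigD1 1%g) //= eqxx scale1r big1 ?addr0 => [|h h1]; last first.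
      rewrite (_ : _ == _ = false) ?scale0r //; apply: contraNF h1 => /eqP h1.
      exact/eqP/val_inj.
    rewrite fmapM compmA (free_laminv Qfree (mulg1 g)) -compmA.
    by rewrite eps_lam1 compm1.
  under eq_bigr => h _ do rewrite -tE ?subgP // scaler_suml.
  rewrite exchange_big fmap_sum comp_sumr comp_suml; apply: eq_bigr => i _.
  under eq_bigr => h _ do rewrite scaler_suml.
  rewrite exchange_big fmap_sum comp_sumr emor_sum comp_suml; apply: eq_bigr => b _.
  under eq_bigr => h _ do rewrite scaler_suml.
  rewrite exchange_big fmap_sum comp_sumr emor_sum comp_suml; apply: eq_bigr => c _.
  under eq_bigr => h _ do rewrite -scalerA.
  rewrite -scaler_sumr fmapZ compZr /=; have := (svalP (fP i b c)).2 g.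
  by rewrite -/(f i b c) => <-; rewrite compZl.
apply: through_sum => i _; apply: through_sum => b _; apply: through_sum => c _.
by apply/throughZ/(through_trans (ITZ i)); exact: (svalP (fP i b c)).1.
Qed.

End Translate.

Section Hom.
Variables (Y : eqcat a H) (d1 d2 : nat).
Variables (r1 : mx_representation k H d1) (r2 : mx_representation k H d2).
Variables (T1 T2 : eqcat a H).
Hypotheses (Y_end : bijective (fun c : k => c *: mid (eob Y)))
  (irr1 : mx_irreducible r1) (irr2 : mx_irreducible r2)
  (tens1 : is_rep_tensor r1 Y T1) (tens2 : is_rep_tensor r2 Y T2).

(** As [Y] has scalar endomorphisms only, [u] amounts to a matrix [M]; equivariance of [u] makes [M]
    an intertwiner, and the inverse matrix from Schur's lemma defines [w]. *)
Lemma rep_tensor_schur (u : mor T1 T2) : u != 0 ->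
  mx_rsim r1 r2 /\ exists w : mor T2 T1, w ∘ u = mid T1 /\ u ∘ w = mid T2.
Proof.
move=> nzu; have [inj1 [sum1 lam1]] := tens1; have [inj2 [sum2 lam2]] := tens2.
have [pr1 [pr1E pr10 pr1S]] := dsum_proj sum1; have [pr2 [pr2E pr20 pr2S]] := dsum_proj sum2.
have [sc scK scK'] := Y_end.
pose M := \matrix_(b, c) sc (pr2 c ∘ emor u ∘ inj1 b).
have uE b : emor u ∘ inj1 b = \sum_c M b c *: inj2 c.
  rewrite -[LHS]comp1m -pr2S comp_suml; apply: eq_bigr => c _.
  by rewrite mxE -[X in _ = _ *: X]compm1 -compZr scK' !compmA.
have comb d d' d'' (A : 'M[k]_(d, d')) (B : 'M[k]_(d', d'')) (X X' : D)
    (f : 'I_d'' -> mor X X') b :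
    \sum_c A b c *: (\sum_e B c e *: f e) = \sum_e (A *m B) b e *: f e.
  under eq_bigr do rewrite scaler_sumr.
  rewrite exchange_big; apply: eq_bigr => e _; rewrite mxE scaler_suml.
  by apply: eq_bigr => c _; rewrite scalerA.
have homM h : h \in H -> r1 h *m M = M *m r2 h.
  move=> hH; apply/matrixP => b c.
  pose ff e := fmap (a h) (inj2 e) ∘ isohom (lam Y hH).
  have E : \sum_e (r1 h *m M) b e *: ff e = \sum_e (M *m r2 h) b e *: ff e.
    rewrite -!comb.
    transitivity (fmap (a h) (emor u) ∘ isohom (lam T1 hH) ∘ inj1 b).
      rewrite -compmA lam1 comp_sumr; apply: eq_bigr => e _.
      rewrite compZr compmA -fmapM uE fmap_sum comp_suml; congr (_ *: _).
      by apply: eq_bigr => e' _; rewrite fmapZ compZl.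
    rewrite emorE -compmA uE comp_sumr; apply: eq_bigr => e _.
    by rewrite compZr lam2.
  have prE (N : 'M_(d1, d2)) : isoinv (lam Y hH) ∘ fmap (a h) (pr2 c) ∘
      (\sum_e N b e *: ff e) = N b c *: mid (eob Y).
    rewrite comp_sumr (bigD1 c) //= big1 ?addr0 => [|e ec].
      rewrite compZr /ff -compmA (compmA (fmap _ _)) -fmapM pr2E fmap1 comp1m.
      by rewrite isoK.
    rewrite compZr /ff -compmA (compmA (fmap _ _)) -fmapM pr20 1?eq_sym //.
    by rewrite fmap0 comp0m compm0 scaler0.
  by apply: (can_inj scK); rewrite -!prE E.
have nzM : M != 0.
  apply: contraNneq nzu => M0; apply/eqP/val_inj/(dsum_eq sum1) => b /=.
  by rewrite uE M0 comp0m big1 // => c _; rewrite mxE scale0r.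
have [rsim [N [MN NM homN]]] := intertwiner_inverse irr1 irr2 homM nzM.
split=> //.
have [w [wE _]] := sum2 _ (fun c => \sum_b N c b *: inj1 b).
have wI : w \in @invariantb _ _ _ a _ T2 T1.
  apply: invariantbP => h hH; apply: (dsum_eq sum2) => c.
  pose ff e := fmap (a h) (inj1 e) ∘ isohom (lam Y hH).
  transitivity (\sum_e (r2 h *m N) c e *: ff e).
    rewrite -comb -compmA lam2 comp_sumr; apply: eq_bigr => e _.
    rewrite compZr compmA -fmapM wE fmap_sum comp_suml; congr (_ *: _).
    by apply: eq_bigr => e' _; rewrite fmapZ compZl.
  rewrite homN // -comb -compmA wE comp_sumr; apply: eq_bigr => e _.
  by rewrite compZr lam1.
have mid_comb d (X X' : D) (f : 'I_d -> mor X X') b : \sum_e (1%:M : 'M[k]_d) b e *: f e = f b.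
  rewrite (bigD1 b) //= mxE eqxx scale1r big1 ?addr0 // => e eb.
  by rewrite mxE eq_sym (negPf eb) scale0r.
exists (EqHom wI); split; apply: val_inj => /=.
  apply: (dsum_eq sum1) => b; rewrite comp1m -compmA uE comp_sumr.
  rewrite -[RHS]mid_comb -MN -comb; apply: eq_bigr => c _.
  by rewrite compZr wE.
apply: (dsum_eq sum2) => b; rewrite comp1m -compmA wE comp_sumr.
rewrite -[RHS]mid_comb -NM -comb; apply: eq_bigr => c _.
by rewrite compZr uE.
Qed.

End Hom.
End RepTensor.

(** * Exceptional collections permuted by the group *)

Section Vanishing.
Variable k : fieldType.

Lemma card_subgroup_unit (gT : finGroupType) (H : {group gT}) :
  (forall p, p \in [pchar k] -> coprime p #|gT|) -> #|H|%:R != 0 :> k.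
Proof.
move=> char_k; apply/negP => H0.
have [p pk] := natf0_pchar (cardG_gt0 H) H0.
have p_dvd : (p %| #|gT|)%N.
  by rewrite -cardsT (dvdn_trans _ (cardSg (subsetT H))) // (dvdn_pcharf pk).
have := char_k p pk; rewrite /coprime (gcdn_idPl p_dvd).
by have /andP[/prime_gt1 p1 _] := pk; rewrite gtn_eqF.
Qed.

Lemma isomorphic_refl (C : lincat k) (X : C) : isomorphic X X.
Proof. by constructor; exists (mid X) (mid X); rewrite comp1m. Qed.

Lemma isomorphic_sym (C : lincat k) (X Y : C) : isomorphic X Y -> isomorphic Y X.
Proof. by case=> [[u v vu uv]]; constructor; exists v u. Qed.

Definition hom0 (C : lincat k) (X Y : C) : Prop := forall f : mor X Y, f = 0.

Lemma hom0_iso (C : lincat k) (X X' Y Y' : C) :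
  isomorphic X X' -> isomorphic Y Y' -> hom0 X Y -> hom0 X' Y'.
Proof.
move=> [[u v vu uv]] [[u' v' vu' uv']] XY f.
have e : v' ∘ f ∘ u = 0 by apply: XY.
rewrite -[f]compm1 -uv compmA -[f]comp1m -uv' -!(compmA u') e.
by rewrite comp0m compm0.
Qed.

Lemma hom0_equivalence (C C' : lincat k) (F : functor C C') (X Y : C) :
  is_equivalence F -> hom0 (F X) (F Y) -> hom0 X Y.
Proof.
move=> [Fff _] FXY f; apply: (bij_inj (Fff X Y)).
by rewrite (FXY (fmap F f)) fmap0.
Qed.

Lemma hom0_dsum (C C' : lincat k) (F : functor C' C) (I J : finType) (X : I -> C)
    (Y : J -> C') P P' (inj : forall i, mor (X i) P) (inj' : forall i, mor (Y i) P') :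
  is_dsum inj -> is_dsum inj' -> (forall i i', hom0 (X i) (F (Y i'))) ->
  hom0 P (F P').
Proof.
move=> sumP /dsum_proj[pr [_ _ prS]] XY f; apply: (dsum_eq sumP) => i.
rewrite comp0m -[f]comp1m -(fmap1 F) -prS fmap_sum !comp_suml big1 // => i' _.
have e : fmap F (pr i') ∘ f ∘ inj i = 0 by apply: XY.
by rewrite fmapM -!compmA (compmA _ f) e compm0.
Qed.

(* If [Hom(E_0, E_j)] is nonzero for some [j <> 0], applying the powers of a
   group element taking [0] to [j] gives an infinite chain of nonzero morphisms
   along which the index increases strictly. *)
Lemma hom0_orbit (gT : finGroupType) (D : tricat k) (a : gaction gT D) l
    (E : 'I_l.+1 -> D) (to : {action gT &-> 'I_l.+1}) :
  [transitive [set: gT], on [set: 'I_l.+1] | to]%g ->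
  (forall g j, isomorphic (a g (E j)) (E (to j g^-1%g))) ->
  (forall i j : 'I_l.+1, (i < j)%N -> hom0 (E j) (E i)) ->
  forall j, j != ord0 -> hom0 (E ord0) (E j).
Proof.
move=> trans to_E semi j nzj; apply: contrapT => nz.
have [x _ jE] := atransP2 trans (in_setT ord0) (in_setT j).
pose pt m := to ord0 (x ^+ m)%g.
have ptS m : pt m.+1 = to j (x ^+ m)%g by rewrite /pt expgS actM -jE.
have nz_m m : ~ hom0 (E (pt m)) (E (pt m.+1)).
  move=> Em; apply: nz.
  (* As [to] is a right action, [a (x ^- m)] moves indices by [x ^+ m]; vanishing at step [m] thus
     pulls back to vanishing at step 0. *)
  apply: (hom0_equivalence (act_equiv a (x ^- m)%g)).
  have iso_m i : isomorphic (E (to i (x ^+ m)%g)) (a (x ^- m)%g (E i)).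
    by have [e] := to_E (x ^- m)%g i; rewrite invgK in e; constructor; exact: iso_sym e.
  by apply: (hom0_iso (iso_m ord0) (iso_m j)); rewrite -ptS.
have incr m : (pt m < pt m.+1)%N.
  rewrite ltnNge leq_eqVlt; apply/negP => /orP[/eqP/val_inj e|lt].
    move: e; rewrite ptS => /act_inj e; by rewrite e eqxx in nzj.
  by apply: (nz_m m); apply: semi.
have ge_m m : (m <= pt m)%N by elim: m => // m IHm; apply: leq_ltn_trans IHm (incr m).
(* At the order of [x] the chain is back at index 0, against [ge_m]. *)
by have := ge_m #[x]%g; rewrite /pt expg_order act1 leqn0 eqn0Ngt order_gt0.
Qed.

Lemma fin_dim_through (C : lincat k) (X Z : C) :
  through Z (mid X) -> fin_dim (mor Z Z) -> fin_dim (mor X X).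
Proof.
move=> [s sE] Zfin; pose n := size s.
pose p (i : 'I_n) := (tnth (in_tuple s) i).1; pose q (i : 'I_n) := (tnth (in_tuple s) i).2.
have {}sE : mid X = \sum_i q i ∘ p i by rewrite sE big_tnth.
apply: (@fin_dim_sum k _ ('I_n * 'I_n)%type (fun=> mor Z Z)
  (fun t f => q t.1 ∘ f ∘ p t.2)) => // [t c x y|f].
  by rewrite comp_linr comp_linl.
exists (fun t => p t.1 ∘ f ∘ q t.2).
rewrite -(pair_bigA _ (fun i i' => q i ∘ (p i ∘ f ∘ q i') ∘ p i')) /=.
rewrite -[LHS]comp1m sE comp_suml; apply: eq_bigr => i _.
rewrite -[X in _ ∘ X = _]compm1 sE !comp_sumr; apply: eq_bigr => i' _.
by rewrite !compmA.
Qed.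

Lemma fin_dim_dsum (C : lincat k) (I : finType) (X : I -> C) P
    (inj : forall i, mor (X i) P) :
  is_dsum inj -> (forall i j, fin_dim (mor (X i) (X j))) -> fin_dim (mor P P).
Proof.
move=> /dsum_proj[pr [_ _ prS]] Xfin.
apply: (@fin_dim_sum k _ (I * I)%type (fun t => mor (X t.1) (X t.2))
  (fun t f => inj t.2 ∘ f ∘ pr t.1)) => // [t c x y|f].
  by rewrite comp_linr comp_linl.
exists (fun t => pr t.2 ∘ f ∘ inj t.1).
rewrite -(pair_bigA _ (fun i i' => inj i' ∘ (pr i' ∘ f ∘ inj i) ∘ pr i)) /=.
rewrite -[LHS]compm1 -prS comp_sumr; apply: eq_bigr => i _.
rewrite -[X in X = _]comp1m -prS !comp_suml; apply: eq_bigr => i' _.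
by rewrite !compmA.
Qed.

End Vanishing.

Theorem theorem3p10 (k : fieldType) (gT : finGroupType)
    (char_k : forall p, p \in [pchar k] -> coprime p #|gT|)
    (* the category and the action; G is the whole group [set: gT] *)
    (D : tricat k) (D_cocomplete : cocomplete D) (D_dg : dgenhancement D)
    (a : gaction gT D) (a_lifts : lifts a D_dg) (D_hom_finite : hom_finite D)
    (* the collection; l_i = (ell i).+1 and the index 1 is ord0 *)
    (n : nat) (ell : 'I_n -> nat) (E : forall i, 'I_(ell i).+1 -> D)
    (E_fsec : full_strong_exceptional_collection (before ell)
                (fun p => E (tag p) (tagged p)))
    (* MathComp actions are right actions: g(j) is [to i j g^-1] *)
    (to : forall i, {action gT &-> 'I_(ell i).+1})
    (to_trans : forall i,
      [transitive [set: gT], on [set: 'I_(ell i).+1] | to i]%g)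
    (to_E : forall i g j, isomorphic (a g (E i j)) (E i (to i j g^-1%g)))
    (H : 'I_n -> {group gT}) (H_stab : forall i, H i = 'C[ord0 | to i]%G)
    (calE : forall i, eqcat a (H i)) (calE_res : forall i, eob (calE i) = E i ord0)
    (Ind : forall i, induction_functor a (H i))
    (* irr(H_i) and the objects rho ⊗ calE_i *)
    (irr : 'I_n -> finType) (deg : forall i, irr i -> nat)
    (rho : forall i (r : irr i), mx_representation k (H i) (deg i r))
    (rho_irr : forall i, irr_representatives (rho i))
    (rhoE : forall i, irr i -> eqcat a (H i))
    (rhoE_tensor : forall i (r : irr i), is_rep_tensor (rho i r) (calE i) (rhoE i r))
    (* the direct sum EE of the collection, and its linearisation induced by
       an isomorphism with the object underlying the sum of the Ind calE_i *)
    (EE : D) (EE_inj : forall p : {i : 'I_n & 'I_(ell i).+1}, mor (E (tag p) (tagged p)) EE)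
    (EE_sum : is_dsum EE_inj)
    (S : eqcat a [set: gT]) (S_inj : forall i, mor (Ind i (calE i)) S)
    (S_sum : is_dsum S_inj)
    (phi : iso EE (eob S))
    (* the direct sum FF of the Ind (rho ⊗ calE_i) *)
    (FF : eqcat a [set: gT])
    (FF_inj : forall q : {i : 'I_n & irr i}, mor (Ind (tag q) (rhoE (tag q) (tagged q))) FF)
    (FF_sum : is_dsum FF_inj) :
  exists B : kalg k,
    is_basic_reduction (skew_alg (end_action (transport phi))) B /\
    alg_isomorphic (endalg FF) B.
Proof.
have H_unit i : #|H i|%:R != 0 :> k := card_subgroup_unit (H i) char_k.
have E_translate i j : exists g, isomorphic (a g (eob (calE i))) (E i j).
  have [x _ ->] := atransP2 (to_trans i) (in_setT ord0) (in_setT j).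
  by exists x^-1%g; have := to_E i x^-1%g ord0; rewrite invgK calE_res.
have calE_end i : bijective (fun c : k => c *: mid (eob (calE i))).
  by rewrite calE_res; have [] := fsec_exceptional E_fsec (existT _ i ord0).
have semi p q : before ell p q -> hom0 (E (tag q) (tagged q)) (E (tag p) (tagged p)).
  (* [shz X 0] is convertible to [X]. *)
  by move=> pq; exact: (fsec_semiorthogonal E_fsec pq (n := 0)).
have calE_iso i g : isomorphic (E i (to i ord0 g^-1%g)) (a g (eob (calE i))).
  by rewrite calE_res; apply: isomorphic_sym; apply: to_E.
(* An element outside the stabiliser moves [ord0], so [hom0_orbit] applies. *)
have calE_off i g : g \notin H i -> hom0 (eob (calE i)) (a g (eob (calE i))).
  move=> gH; apply: (hom0_iso (isomorphic_refl _) (calE_iso i g)); rewrite calE_res.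
  apply: (hom0_orbit (to_trans i) (to_E i)) => [j j' jj'|].
    by apply: (semi (existT _ i j) (existT _ i j')); rewrite /before /= eqxx jj' orbT.
  apply: contra gH => /eqP e; rewrite H_stab -groupV; exact/astab1P.
have calE_lt (i i' : 'I_n) g : (i' < i)%N -> hom0 (eob (calE i)) (a g (eob (calE i'))).
  move=> ii'; apply: (hom0_iso (isomorphic_refl _) (calE_iso i' g)); rewrite calE_res.
  by apply: (semi (existT _ i' _) (existT _ i _)); rewrite /before /= ii'.
have rhoE_off i (r r' : irr i) g : g \notin H i ->
    hom0 (eob (rhoE i r)) (a g (eob (rhoE i r'))).
  move=> gH; have [inj [sumT _]] := rhoE_tensor i r.
  have [inj' [sumT' _]] := rhoE_tensor i r'.
  by apply: (hom0_dsum sumT sumT') => _ _; apply: calE_off.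
have rhoE_lt (i i' : 'I_n) (r : irr i) (r' : irr i') g : (i' < i)%N ->
    hom0 (eob (rhoE i r)) (a g (eob (rhoE i' r'))).
  move=> ii'; have [inj [sumT _]] := rhoE_tensor i r.
  have [inj' [sumT' _]] := rhoE_tensor i' r'.
  by apply: (hom0_dsum sumT sumT') => _ _; apply: calE_lt.
pose X0 : eqcat a [set: gT] := transport phi.
have [Q [j Qfree]] : exists (Q : eqcat a [set: gT]) (j : forall g, mor (a g EE) (eob Q)),
    is_free j := free_exists a EE D_cocomplete.
pose F (q : {i : 'I_n & irr i}) := Ind (tag q) (rhoE (tag q) (tagged q)).
have [prE [prE1 prE0 prES]] := dsum_proj EE_sum.
have [prF [prF1 prF0 prFS]] := dsum_proj FF_sum.
(* [F q] is a retract of the free object on the object underlying rho ⊗ calE_i, which is a multiple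
   of a summand of [EE]. *)
have FQ q : @through k (eqcat a [set: gT]) Q _ _ (mid (F q)).
  rewrite /F; set Y := rhoE _ _; set i := tag q.
  have [Q' [j' Q'free]] : exists (Q' : eqcat a [set: gT])
      (j' : forall g, mor (a g (eob Y)) (eob Q')), is_free j'.
    exact: free_exists.
  have [eta [etaP _]] := ind_unit (Ind i).
  have [theta [zeta [<- _ _]]] := induced_retract (H_unit i) (etaP Y) Q'free.
  apply: (through_trans (Y := Q')); last exact: through_comp.
  have [inj [/dsum_proj[pr [_ _ prS]] _]] := rhoE_tensor i (tagged q).
  have [u [v vu]] : exists (u : mor (eob (calE i)) EE) v, v ∘ u = mid (eob (calE i)).
    rewrite calE_res; exists (EE_inj (existT _ i ord0)), (prE (existT _ i ord0)).
    exact: (prE1 (existT _ i ord0)).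
  (* [free_through_mid] expects translates of [EE]; the linearisation identifies [EE] with its
     translate by 1. *)
  have L : iso EE (a 1%g EE) := lam X0 (in_setT 1%g).
  apply: (free_through_mid (g := fun=> 1%g) (Y := fun=> EE) (Q := fun=> Q) (j := fun=> j)
    (p := fun b => isohom L ∘ (u ∘ pr b))
    (q := fun b => inj b ∘ v ∘ isoinv L)
    Q'free (fun=> Qfree)) => [_|].
    by rewrite -[mid Q]comp1m; apply: through_comp.
  rewrite -[RHS]prS; apply: eq_bigr => b _.
  by rewrite -!compmA (comp_cancell _ (isoK _)) (comp_cancell _ vu).
have FF_Q : through Q (mid FF).
  rewrite -prFS; apply: through_sum => q _.
  have := through_sandwich (FF_inj q) (prF q) (FQ q).
  by rewrite compm1.
(* [EE] is a sum of translates of the [calE i], and [free_through_irr] takes the free objects on the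
   latter through [FF]. *)
have Q_FF : @through k (eqcat a [set: gT]) FF _ _ (@mid k (eqcat a [set: gT]) Q).
  have tr (t : {i : 'I_n & 'I_(ell i).+1}) :
      {g & {u : mor (a g (eob (calE (tag t)))) (E (tag t) (tagged t)) &
      {v | u ∘ v = mid _}}}.
    have /cid[g gE] := E_translate (tag t) (tagged t); exists g.
    have uvP : exists (u : mor (a g (eob (calE (tag t)))) (E (tag t) (tagged t))) v,
        u ∘ v = mid _ by have [[u v vu uv]] := gE; exists u, v.
    by have /cid[u /cid[v uv]] := uvP; exists u, v.
  have fr (t : {i : 'I_n & 'I_(ell i).+1}) : {Q' : eqcat a [set: gT] &
      {j' : forall g, mor (a g (eob (calE (tag t)))) (eob Q') | is_free j'}}.
    have /cid[Q' /cid[j' Q'free]] := free_exists a (eob (calE (tag t))) D_cocomplete.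
    by exists Q', j'.
  pose g t := projT1 (tr t); pose u t := projT1 (projT2 (tr t)).
  pose v t := sval (projT2 (projT2 (tr t))).
  have uv t : u t ∘ v t = mid _ := svalP (projT2 (projT2 (tr t))).
  apply: (free_through_mid (g := g) (j := fun t => sval (projT2 (fr t)))
    (p := fun t => v t ∘ prE t) (q := fun t => EE_inj t ∘ u t) Qfree) => [t|t|].
  - exact: svalP (projT2 (fr t)).
  - have [eta [etaP _]] := ind_unit (Ind (tag t)).
    apply: (free_through_irr (svalP (projT2 (fr t))) (H_unit _) (rho_irr _)
      (rhoE_tensor (tag t)) (fun r => etaP (rhoE (tag t) r))) => r.
    by rewrite -(prF1 (existT _ (tag t) r)); apply: through_comp.
  - by rewrite -[RHS]prES; apply: eq_bigr => t _; rewrite -compmA (comp_cancell _ (uv t)).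
(* The reduction is End([FF]) itself; Morita equivalence and basicness remain. *)
exists (@endalg k (eqcat a [set: gT]) FF); split; last first.
  by exists id; split=> //; exists id.
split; last first.
  have skew := skew_alg_isomorphic (X := X0) Qfree.
  exact: morita_alg_isomorphic skew (morita_through Q_FF FF_Q).
have F_neq0 q : ~ is_zero (F q).
  have [eta [etaP _]] := ind_unit (Ind (tag q)).
  apply: (induced_neq0 (H_unit _) (etaP _) D_cocomplete) => rho0.
  have [irr_rho _ _] := rho_irr (tag q).
  have [deg_gt0 _] := proj1 (mx_irrP _) (irr_rho (tagged q)).
  have [inj [/dsum_proj[pr [pr1 _ _]] _]] := rhoE_tensor (tag q) (tagged q).
  have Y0 : mid (eob (calE (tag q))) = 0.
    by rewrite -(pr1 (Ordinal deg_gt0)) -[inj _]comp1m rho0 comp0m compm0.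
  have /bij_inj/(_ 1 0) := calE_end (tag q); rewrite Y0 !scaler0 => /(_ erefl)/eqP.
  by rewrite oner_eq0.
apply: (basic_endalg FF_sum) => [|q|q e ee|[i r] [i' r'] qq'].
(* Finite dimension passes from the Hom spaces of the collection to End([EE]), the skew group
   algebra, End([Q]) and finally End([FF]). *)
- apply: (fin_dim_through FF_Q).
  have [h [[h' hK h'K] h_lin _ _]] := skew_alg_isomorphic (X := X0) Qfree.
  apply: (fin_dim_image (l := h') _ (fin_dim_ffun gT (fin_dim_dsum EE_sum _))).
  + by move=> c x y; apply: (can_inj hK); rewrite h_lin !h'K.
  + move=> p q; have [Ep _ _] := fsec_exceptional E_fsec p.
    have [Eq _ _] := fsec_exceptional E_fsec q.
    by have [/(_ 0)] := D_hom_finite _ _ Ep Eq.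
  + by move=> f; exists (h f); rewrite hK.
- exact: F_neq0.
(* An idempotent is induced from some [v]; a nonzero [v] is invertible by Schur, and an invertible
   idempotent is the identity. *)
- have [v eE] := induction_full e (H_unit _) D_cocomplete (rhoE_off _ _ _).
  have [v0|nzv] := eqVneq v 0; first by left; rewrite eE v0 fmap0.
  have [irr_rho _ _] := rho_irr (tag q).
  have [_ [w [wv _]]] := rep_tensor_schur (calE_end _) (irr_rho _) (irr_rho _)
    (rhoE_tensor _ _) (rhoE_tensor _ _) nzv.
  right; rewrite -[e]comp1m -(fmap1 (Ind _)) -wv fmapM -eE -compmA ee.
  by rewrite eE -fmapM wv fmap1.
(* Between different blocks, all morphisms from the later to the earlier one vanish, so an
   isomorphism would make a nonzero object zero. Within a block, Schur's lemma compares the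
   representations. *)
- have F_lt (i1 i2 : 'I_n) (r1 : irr i1) (r2 : irr i2) : (i2 < i1)%N ->
      @hom0 k (eqcat a [set: gT]) (F (existT _ i1 r1)) (F (existT _ i2 r2)).
    move=> lt f; have [eta1 [eta1P _]] := ind_unit (Ind i1).
    have [eta2 [eta2P _]] := ind_unit (Ind i2).
    apply: (induced_inj (eta1P _)); rewrite comp0m.
    by apply: (induced_vanish (H_unit _) (eta2P _) _ D_cocomplete) => g; apply: rhoE_lt.
  have [[u v vu uv]] := qq'; case: (ltngtP i i') => [lt|lt|/val_inj ii'].
  + case: (F_neq0 (existT _ i r)); rewrite /is_zero -vu.
    by rewrite [v](F_lt _ _ _ _ lt) comp0m.
  + case: (F_neq0 (existT _ i r)); rewrite /is_zero -vu.
    by rewrite [u](F_lt _ _ _ _ lt) compm0.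
  subst i'; have [w uE] := induction_full u (H_unit _) D_cocomplete (rhoE_off _ _ _).
  have [w0|nzw] := eqVneq w 0.
    case: (F_neq0 (existT _ i r)); rewrite /is_zero -vu.
    by rewrite uE w0 fmap0 compm0.
  have [irr_rho rho_inj _] := rho_irr i.
  have [rsim _] := rep_tensor_schur (calE_end _) (irr_rho _) (irr_rho _)
    (rhoE_tensor _ _) (rhoE_tensor _ _) nzw.
  by rewrite (rho_inj r r' rsim).
Qed.
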